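(* Let $T(\mathcal{A}^n)$ denote the waiting time until some pattern of the collection $\mathcal{A}^n$ appears in a simple symmetric random walk. (1) There exists a constant $C_{\mathcal{E}}>0$ such that $\mathbb{E}T(\mathcal{E}^{2n})\sim C_{\mathcal{E}}\,n^{3/2}$ as $n\to\infty$. (2) There exists a constant $C_{\mathcal{M}}>0$ such that $\mathbb{E}T(\mathcal{M}^{2n+1})\sim C_{\mathcal{M}}\,n$ as $n\to\infty$. (3) For each $\lambda\in\mathbb{R}$, there exist constants $c^\lambda_{\mathcal{BR}},C^\lambda_{\mathcal{BR}}>0$ such that, for all sufficiently large $n$, $c^\lambda_{\mathcal{BR}}\,n\le\mathbb{E}T(\mathcal{BR}^{\lambda,n})\le C^\lambda_{\mathcal{BR}}\,n$. (4) For each $\lambda<0$, there exist constants $c^\lambda_{\mathcal{FP}},C^\lambda_{\mathcal{FP}}>0$ such that, for all sufficiently large $n$, $c^\lambda_{\mathcal{FP}}\,n\le\mathbb{E}T(\mathcal{FP}^{\lambda,n})\le C^\lambda_{\mathcal{FP}}\,n^{5/4}$.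
   Context: $SW(n)$ denotes the set of walks $w=(w(0),\dots,w(n))$ of length $n$ with $w(0)=0$ and increments $w(i)-w(i-1)\in\{-1,+1\}$. Let $(RW_k)_{k\ge 0}$ be a simple symmetric random walk with $RW_0=0$ (i.i.d. increments equal to $\pm1$ with probability $1/2$ each). For a collection $\mathcal{A}\subset SW(N)$ of patterns of common length $N$, $T(\mathcal{A}):=\inf\{k+N;\ k\ge 0,\ (RW_{k+i}-RW_k)_{0\le i\le N}\in\mathcal{A}\}$ is the first time by which some pattern of $\mathcal{A}$ has been completely observed. For $\lambda\in\mathbb{R}$, let $\lambda_n=[\lambda\sqrt n]$ if $[\lambda\sqrt n]$ and $n$ have the same parity, and $\lambda_n=[\lambda\sqrt n]+1$ otherwise, where $[\cdot]$ denotes the integer part. Define: $\mathcal{E}^{2n}:=\{w\in SW(2n); w(i)>0 \text{ for } 1\le i\le 2n-1 \text{ and } w(2n)=0\}$; $\mathcal{M}^{2n+1}:=\{w\in SW(2n+1); w(i)>0 \text{ for } 1\le i\le 2n+1\}$; $\mathcal{BR}^{\lambda,n}:=\{w\in SW(n); w(n)=\lambda_n\}$; for $\lambda<0$, $\mathcal{FP}^{\lambda,n}:=\{w\in SW(n); w(i)>w(n)=\lambda_n \text{ for } 0\le i\le n-1\}$. $a_n\sim b_n$ means $a_n/b_n\to1$. *)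

(* Defs.v *)
From HB Require Import structures.
From mathcomp Require Export all_boot all_order all_algebra finmap.
From mathcomp Require Export all_classical all_reals all_analysis.

Set Implicit Arguments.
Unset Strict Implicit.
Unset Printing Implicit Defensive.

Export Order.TTheory GRing.Theory Num.Theory.
Export numFieldNormedType.Exports.

#[global] Open Scope classical_set_scope.
#[global] Open Scope ring_scope.

(* A path of length n is the vector of its n + 1 values w(0), ..., w(n).
   Values are taken in R, like those of the random walk it is compared with;
   on [SW R n] they are automatically integers. *)
Definition path_of (R : realType) (n : nat) := 'I_n.+1 -> R.

Definition SW (R : realType) (n : nat) : set (path_of R n) :=
  [set w | w ord0 = 0 /\
    forall i j : 'I_n.+1, j = i.+1 :> nat -> w j - w i = 1 \/ w j - w i = -1].
Arguments SW : clear implicits.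

Definition excursions (R : realType) (n : nat) : set (path_of R (2 * n)) :=
  [set w | [/\ SW R (2 * n) w,
    forall i : 'I_(2 * n).+1, (1 <= i <= 2 * n - 1)%N -> 0 < w i &
    w ord_max = 0]].
Arguments excursions : clear implicits.

Definition meanders (R : realType) (n : nat) : set (path_of R (2 * n + 1)) :=
  [set w | SW R (2 * n + 1) w /\
    forall i : 'I_(2 * n + 1).+1, (1 <= i <= 2 * n + 1)%N -> 0 < w i].
Arguments meanders : clear implicits.

(* The integer part is the floor, also for negative arguments. *)
Definition lambda_int (R : realType) (lam : R) (n : nat) : int :=
  let m := Num.floor (lam * Num.sqrt n%:R) in
  if (m == n%:Z %[mod 2])%Z then m else m + 1.

Definition bridges (R : realType) (lam : R) (n : nat) : set (path_of R n) :=
  [set w | SW R n w /\ w ord_max = (lambda_int lam n)%:~R].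
Arguments bridges {R} lam n _.

Definition first_passages (R : realType) (lam : R) (n : nat) :
    set (path_of R n) :=
  [set w | [/\ SW R n w,
    forall i : 'I_n.+1, (i < n)%N -> w ord_max < w i &
    w ord_max = (lambda_int lam n)%:~R]].
Arguments first_passages {R} lam n _.

Definition mutually_independent d (T : measurableType d) (R : realType)
    (P : probability T R) (X : nat -> T -> R) : Prop :=
  forall (J : {fset nat}) (B : nat -> set R),
    (forall j, measurable (B j)) ->
    P (\bigcap_(j in [set` J]) (X j @^-1` B j)) =
    (\prod_(j <- J) P (X j @^-1` B j))%E.

Record simple_random_walk d (T : measurableType d) (R : realType)
    (P : probability T R) (RW : nat -> {RV P >-> R}) : Prop := {
  srw_start : forall t, RW 0%N t = 0;
  srw_up : forall k, P [set t | RW k.+1 t - RW k t = 1] = (2^-1)%:E;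
  srw_down : forall k, P [set t | RW k.+1 t - RW k t = -1] = (2^-1)%:E;
  srw_indep : mutually_independent P (fun k t => RW k.+1 t - RW k t) }.

(* First time by which a pattern of A has been completely observed
   (+oo if this never happens). *)
Definition waiting_time d (T : measurableType d) (R : realType)
    (P : probability T R) (RW : nat -> {RV P >-> R})
    (N : nat) (A : set (path_of R N)) (t : T) : \bar R :=
  ereal_inf [set ((k + N)%N%:R)%:E | k in
    [set k | A (fun i : 'I_N.+1 => RW (k + i)%N t - RW k t)]].

(* The library's ['E_P[X]] is restricted to real-valued X, whereas the waiting
   time may be infinite. *)
Definition expected_waiting_time d (T : measurableType d) (R : realType)
    (P : probability T R) (RW : nat -> {RV P >-> R})
    (N : nat) (A : set (path_of R N)) : \bar R :=
  (\int[P]_t waiting_time RW A t)%E.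

Definition asymp_equiv (R : realType) (a b : nat -> \bar R) : Prop :=
  (a n / b n)%E @[n --> \oo] --> 1%E.

(* Main.v *)
Require Import Defs.
From mathcomp Require Import zify ring lra measurable_realfun.

Set Implicit Arguments.
Unset Strict Implicit.
Unset Printing Implicit Defensive.

(* The walk is coded by the word of its up/down bits, and [v m] denotes the
   probability that no pattern has been completed by time [m], so that
   E T = sum_m v(m).  Fix patterns of length [N] and total probability [p].  If a
   pattern occupies (k, k+N] and none is completed by time k, then the first
   completion happens at time k+N-j for exactly one j < N.  If [c j] bounds the
   conditional probability that an occurrence is followed by another one [j]
   steps later (c 0 = 1), summing over [k] yields
     1 <= p * E T <= sum_(j < N) c j.
   - Excursions never overlap, hence E T = 1 / p, and p is explicit in terms of
     the return probability u_n = P(S_(2n) = 0).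
   - For bridges c j is of order j^(-1/2) and p of order n^(-1/2).
   - For first passage bridges, an occurrence j steps later forces the last j
     steps to be a first passage at a prescribed level, an event of probability
     at most 2 / j by the hitting time theorem and unimodality; p is of order
     1 / n, so E T = O(n log n), which is stronger than O(n^(5/4)).
   A failed attempt at a meander is a down step or an excursion of length at
   most 2n, after which the search starts afresh; this renewal equation gives
   E T = 4n + 1 + 1 / u_n. *)

(** * Averages over binary words and pattern avoidance *)

Section Averages.
Variable R : realType.
Implicit Types (f g : seq bool -> R) (s : seq bool).

(** Expectation of [f] under [n] fair coin tosses. Recursing on the first letter makes first-step
    analysis a computation. *)
Fixpoint avg (n : nat) (f : seq bool -> R) : R :=
  if n is n'.+1
  then (avg n' (fun s => f (true :: s)) + avg n' (fun s => f (false :: s))) / 2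
  else f [::].

Lemma eq_avg n f g :
  (forall s, size s = n -> f s = g s) -> avg n f = avg n g.
Proof.
elim: n f g => [|n IHn] f g fg /=; first exact: fg.
by congr ((_ + _) / 2); apply: IHn => s szs; apply: fg; rewrite /= szs.
Qed.

Lemma ler_avg n f g :
  (forall s, size s = n -> f s <= g s) -> avg n f <= avg n g.
Proof.
elim: n f g => [|n IHn] f g fg /=; first exact: fg.
by rewrite ler_pM2r ?invr_gt0// lerD//; apply: IHn => s szs; apply: fg;
  rewrite /= szs.
Qed.

Lemma avg_cst n (c : R) : avg n (fun=> c) = c.
Proof. by elim: n => //= n ->; rewrite mulrDl -splitr. Qed.

Lemma avgD n f g : avg n (fun s => f s + g s) = avg n f + avg n g.
Proof. by elim: n f g => //= n IHn f g; rewrite !IHn; lra. Qed.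

Lemma avgZ n (c : R) f : avg n (fun s => c * f s) = c * avg n f.
Proof. by elim: n f => //= n IHn f; rewrite !IHn; lra. Qed.

Lemma avgB n f g : avg n (fun s => f s - g s) = avg n f - avg n g.
Proof. by elim: n f g => //= n IHn f g; rewrite !IHn; lra. Qed.

Lemma avg_sum n (I : Type) (r : seq I) (P : pred I) (F : I -> seq bool -> R) :
  avg n (fun s => \sum_(i <- r | P i) F i s) = \sum_(i <- r | P i) avg n (F i).
Proof.
elim: r => [|i r IHr].
  by rewrite big_nil -[RHS](avg_cst n); apply: eq_avg => s _; rewrite big_nil.
rewrite big_cons -IHr; case: ifP => Pi; last first.
  by apply: eq_avg => s _; rewrite big_cons Pi.
by rewrite -avgD; apply: eq_avg => s _; rewrite big_cons Pi.
Qed.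

Lemma avg_ge0 n f : (forall s, size s = n -> 0 <= f s) -> 0 <= avg n f.
Proof. by move=> f0; rewrite -(avg_cst n 0); exact: ler_avg. Qed.

Lemma avg_cat m n f :
  avg (m + n) f = avg m (fun s => avg n (fun z => f (s ++ z))).
Proof. by elim: m f => //= m IHm f; rewrite !IHm. Qed.

Lemma avg_take m n f : avg (m + n) (fun s => f (take m s)) = avg m f.
Proof.
rewrite avg_cat; apply: eq_avg => s szs.
by rewrite -[RHS](avg_cst n); apply: eq_avg => z _; rewrite take_size_cat.
Qed.

(** Independence of the first [m] letters from the last [n]. *)
Lemma avg_take_drop m n f g :
  avg (m + n) (fun s => f (take m s) * g (drop m s)) = avg m f * avg n g.
Proof.
rewrite avg_cat mulrC -avgZ; apply: eq_avg => s szs.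
rewrite mulrC -avgZ; apply: eq_avg => z _.
by rewrite take_size_cat// drop_size_cat.
Qed.

Definition prob (n : nat) (A : pred (seq bool)) : R :=
  avg n (fun s => (A s)%:R).

Lemma prob_ge0 n A : 0 <= prob n A.
Proof. exact: avg_ge0. Qed.

Lemma prob_le1 n A : prob n A <= 1.
Proof. by rewrite -(avg_cst n 1); apply: ler_avg => s _; case: (A s). Qed.

Lemma eq_prob n (A B : pred (seq bool)) :
  (forall s, size s = n -> A s = B s) -> prob n A = prob n B.
Proof. by move=> AB; apply: eq_avg => s /AB ->. Qed.

Lemma ler_prob n (A B : pred (seq bool)) :
  (forall s, size s = n -> A s -> B s) -> prob n A <= prob n B.
Proof.
move=> AB; apply: ler_avg => s /AB; case: (A s) => [->//|_].
by rewrite ler0n.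
Qed.

Lemma probS n (A : pred (seq bool)) :
  prob n.+1 A = (prob n (fun s => A (true :: s)) +
                 prob n (fun s => A (false :: s))) / 2.
Proof. by []. Qed.

Lemma prob0 n (A : pred (seq bool)) :
  (forall s, size s = n -> ~~ A s) -> prob n A = 0.
Proof.
by move=> A0; rewrite -[RHS](avg_cst n); apply: eq_avg => s /A0/negbTE ->.
Qed.

End Averages.
Arguments prob R n A : clear implicits.

(** * Words without a pattern, and first completion *)

Section Avoidance.
Variables (N : nat) (A : pred (seq bool)).
Implicit Types s z : seq bool.

(** The truncated difference leaves no window to test when [s] is shorter than [N]. *)
Definition avoid s :=
  all (fun k => ~~ A (take N (drop k s))) (iota 0 ((size s).+1 - N)).

Lemma avoidP s :
  reflect (forall k, (k + N <= size s)%N -> ~~ A (take N (drop k s))) (avoid s).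
Proof.
apply: (iffP allP) => H k.
- by move=> kN; apply: H; rewrite mem_iota; lia.
- by rewrite mem_iota => kN; apply: H; lia.
Qed.

Lemma avoidPn s :
  reflect (exists2 k, (k + N <= size s)%N & A (take N (drop k s)))
          (~~ avoid s).
Proof.
apply: (iffP allPn) => -[k kN].
- by rewrite negbK => Ak; exists k => //; move: kN; rewrite mem_iota; lia.
- by move=> Ak; exists k; rewrite ?negbK// mem_iota; lia.
Qed.

Lemma avoid_short s : (size s < N)%N -> avoid s.
Proof. by move=> sN; apply/avoidP => k; lia. Qed.

Lemma avoid_cons b s :
  avoid (b :: s) =
  ((N <= (size s).+1)%N ==> ~~ A (take N (b :: s))) && avoid s.
Proof.
apply/avoidP/andP => [H|[/implyP H0 /avoidP H] [|k] kN].
- split; first by apply/implyP => Ns; apply: (H 0%N).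
  by apply/avoidP => k kN; apply: (H k.+1).
- exact: H0.
- exact: H.
Qed.

Lemma avoid_take m n s : (m <= n)%N -> avoid (take n s) -> avoid (take m s).
Proof.
move=> mn /avoidP H; apply/avoidP => k; rewrite size_take_min leq_min.
move=> /andP[km ks]; have := H k; rewrite size_take_min leq_min.
rewrite (leq_trans km mn) ks => /(_ isT).
by rewrite !take_drop !take_takel // addnC // (leq_trans km).
Qed.

Lemma avoid_takeW n s : avoid s -> avoid (take n s).
Proof.
case: (leqP n (size s)) => [ns|/ltnW ns]; last by rewrite take_oversize.
by rewrite -{1}(take_size s); exact: avoid_take.
Qed.

(** The first completion time is the length of [s]. *)
Definition completed s := avoid (take (size s).-1 s) && ~~ avoid s.

(** Deleting the last letter removes every occurrence, so the only one is the final window. *)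
Lemma completed_last s : completed s ->
  (N <= size s)%N /\ A (drop (size s - N) s).
Proof.
move=> /andP[/avoidP Hav /avoidPn[k kN Ak]].
have [ks|ks] := leqP (k + N) (size s).-1.
  have := Hav k; rewrite size_take_min leq_min ks kN => /(_ isT).
  rewrite take_drop take_takel; last by rewrite addnC.
  by rewrite -take_drop => /negP.
have -> : (size s - N = k)%N by lia.
split; first by lia.
by move: Ak; rewrite take_oversize// size_drop; lia.
Qed.

End Avoidance.

(** * Overlap bounds *)

Lemma drop_cat_le (T : Type) (n : nat) (s1 s2 : seq T) :
  (n <= size s1)%N -> drop n (s1 ++ s2) = drop n s1 ++ s2.
Proof.
rewrite drop_cat; case: ltngtP => // -> _.
by rewrite subnn drop0 drop_size.
Qed.

Section Survival.
Variables (R : realType) (N : nat) (A : pred (seq bool)).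
Hypothesis N0 : (0 < N)%N.

Definition survival (m : nat) : R := prob R m (avoid N A).

Lemma survival_ge0 m : 0 <= survival m. Proof. exact: prob_ge0. Qed.

Lemma survival_le1 m : survival m <= 1. Proof. exact: prob_le1. Qed.

Lemma survival_short m : (m < N)%N -> survival m = 1.
Proof.
move=> mN; rewrite -(avg_cst m (1 : R)); apply: eq_avg => s szs.
by rewrite avoid_short// szs.
Qed.

Lemma prob_completed m :
  prob R m.+1 (completed N A) = survival m - survival m.+1.
Proof.
rewrite /survival /prob -(avg_take m 1) addn1 -avgB; apply: eq_avg => s szs.
rewrite /completed szs; have := @avoid_takeW N A m s.
by case: (avoid N A s) => [->//|_]; rewrite ?subrr ?andbT ?subr0.
Qed.

Lemma sum_prob_completed m K :
  \sum_(0 <= k < K) prob R (k + m).+1 (completed N A) =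
  survival m - survival (K + m).
Proof.
under eq_bigr do rewrite prob_completed -opprB.
rewrite sumrN (telescope_sumr (fun k => survival (k + m)))// opprB.
by rewrite add0n.
Qed.

Lemma survival_prob k :
  survival k * prob R N A =
  avg (k + N) (fun s => (avoid N A (take k s))%:R * (A (drop k s))%:R).
Proof. by rewrite -avg_take_drop. Qed.

(** A first completion at time [k + N] needs a pattern in the last [N] letters and none in the first
    [k], and these two events are independent. *)
Lemma prob_completed_le k :
  prob R (k + N) (completed N A) <= survival k * prob R N A.
Proof.
rewrite survival_prob; apply: ler_avg => s szs.
case Hc: (completed N A s); last by rewrite mulr_ge0.
have [_] := completed_last Hc; rewrite szs addnK => ->.
move: Hc => /andP[Hav _]; rewrite (@avoid_take _ _ k (size s).-1)//.
  by rewrite mulr1.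
by lia.
Qed.

(** First completions at times [N, ..., N + K - 1] telescope, starting from [survival N.-1 = 1].
    Once survival tends to 0, this yields [1 <= p * E T]. *)
Lemma sum_survival_ge K :
  1 - survival (K + N.-1) <= prob R N A * \sum_(0 <= k < K) survival k.
Proof.
rewrite -(@survival_short N.-1); last by lia.
rewrite -sum_prob_completed mulr_sumr; apply: ler_sum => k _.
by rewrite -addnS prednK// mulrC prob_completed_le.
Qed.

Variable c : nat -> R.
Hypothesis c0 : forall j, 0 <= c j.
Hypothesis overlap : forall j r, (j < N)%N -> size r = N -> A r ->
  prob R j (fun z => A (drop j (r ++ z))) <= c j.

(* A pattern observed at the end of a word splits that word at the first
   completion time, which precedes the end by some [j < N]. *)
Lemma first_completion k s : size s = (k + N)%N ->
  avoid N A (take k s) -> A (drop k s) ->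
  exists2 j, (j < N)%N & completed N A (take (k + N - j) s).
Proof.
move=> szs Hav Ak.
have exm : exists m, ~~ avoid N A (take m s).
  exists (k + N)%N; rewrite take_oversize ?szs//; apply/avoidPn; exists k.
    by rewrite szs.
  by rewrite take_oversize// size_drop; lia.
pose m := ex_minn exm.
have [mav mmin] : ~~ avoid N A (take m s) /\
    forall m', ~~ avoid N A (take m' s) -> (m <= m')%N.
  by rewrite /m; case: ex_minnP.
have km : (k < m)%N.
  rewrite ltnNge; apply/negP => mk; move/negP: mav; apply.
  exact: avoid_take Hav.
have ms : (m <= k + N)%N.
  apply: mmin; rewrite take_oversize ?szs//; apply/avoidPn; exists k.
    by rewrite szs.
  by rewrite take_oversize// size_drop; lia.
exists (k + N - m)%N; first by lia.
rewrite subKn// /completed mav andbT size_take_min szs (minn_idPl ms).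
rewrite take_takel ?leq_pred//.
by apply/negPn/negP => /mmin; lia.
Qed.

(** Split by the first completion time [k + N - j]. The word read by then ends in a pattern, and the
    [j] fresh letters must produce the one at [k], which [overlap] bounds by [c j]. *)
Lemma survival_prob_le k :
  survival k * prob R N A <=
  \sum_(0 <= j < N) c j * prob R (k + N - j) (completed N A).
Proof.
rewrite survival_prob.
pose F j s : R := (completed N A (take (k + N - j) s))%:R * (A (drop k s))%:R.
apply: (@le_trans _ _ (avg (k + N) (fun s => \sum_(0 <= j < N) F j s))).
  apply: ler_avg => s szs.
  have F0 j : 0 <= F j s by rewrite mulr_ge0.
  case Hav : (avoid N A (take k s)); last by rewrite mul0r sumr_ge0.
  case Ak : (A (drop k s)); last by rewrite mulr0 sumr_ge0.
  have [j jN Hc] := first_completion szs Hav Ak.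
  rewrite big_mkord (bigD1 (Ordinal jN))//= {1}/F Hc Ak !mulr1 lerDl.
  by rewrite sumr_ge0.
rewrite avg_sum; apply: ler_sum_nat => j /andP[_ jN].
have -> : avg (k + N) (F j) = avg (k + N - j + j) (F j) by rewrite subnK//; lia.
rewrite avg_cat -avgZ; apply: ler_avg => s szs.
case Hc : (completed N A s); last first.
  rewrite mulr0 -[leRHS](avg_cst j) le_eqVlt; apply/orP; left; apply/eqP.
  by apply: eq_avg => z _; rewrite /F take_size_cat// Hc mul0r.
have [Ns As] := completed_last Hc.
rewrite mulr1; apply: le_trans (overlap jN _ As); last first.
  by rewrite size_drop; lia.
apply: ler_avg => z szz.
rewrite /F take_size_cat// Hc mul1r.
(* [Ns] forces [j <= k], so dropping [k] letters is dropping [k - j = size s - N] and then [j]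
   more. *)
rewrite -drop_cat_le ?szs; last by lia.
by rewrite drop_drop (_ : j + _ = k)%N//; lia.
Qed.

(** After exchanging the sums, for each [j] the first completions at distinct times have total
    probability at most 1. *)
Lemma sum_survival_le K :
  prob R N A * \sum_(0 <= k < K) survival k <= \sum_(0 <= j < N) c j.
Proof.
rewrite mulr_sumr.
apply: (@le_trans _ _ (\sum_(0 <= k < K) \sum_(0 <= j < N)
    c j * prob R (k + N - j) (completed N A))).
  by apply: ler_sum => k _; rewrite mulrC survival_prob_le.
rewrite exchange_big/=; apply: ler_sum_nat => j /andP[_ jN].
rewrite -mulr_sumr -[leRHS]mulr1 ler_wpM2l//.
have -> : \sum_(0 <= k < K) prob R (k + N - j) (completed N A) =
    \sum_(0 <= k < K) prob R (k + (N - j).-1).+1 (completed N A).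
  by apply: eq_bigr => k _; congr prob; lia.
rewrite sum_prob_completed.
by have := survival_ge0 (K + (N - j).-1); have := survival_le1 (N - j).-1; lra.
Qed.

End Survival.

(** * The waiting time as a series *)

Definition step (b : bool) : int := if b then 1 else -1.

Definition hgt (s : seq bool) : int := \sum_(b <- s) step b.

Lemma hgt_nil : hgt [::] = 0. Proof. by rewrite /hgt big_nil. Qed.

Lemma hgt_cons b s : hgt (b :: s) = step b + hgt s.
Proof. by rewrite /hgt big_cons. Qed.

Lemma hgt_cat s z : hgt (s ++ z) = hgt s + hgt z.
Proof. by rewrite /hgt big_cat. Qed.

Lemma hgt_take_nth s i : (i < size s)%N ->
  hgt (take i.+1 s) = hgt (take i s) + step (nth false s i).
Proof.
by move=> ilt; rewrite (take_nth false ilt) /hgt -cats1 big_cat/= big_seq1.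
Qed.

(** Links real-valued paths to words; in particular every member of [A] has steps +1 or -1. *)
Definition encodes (R : realType) N (A' : pred (seq bool))
    (A : set (path_of R N)) :=
  forall w, A w <-> exists s, [/\ size s = N, A' s &
    forall i : 'I_N.+1, w i = (hgt (take i s))%:~R].

Section SeriesOfIndicators.
Variables (R : realType) (N : nat) (Q : nat -> Prop).

(** An integer time is the sum over [m] of the indicators that it exceeds [m]; if [Q] never holds,
    both sides are infinite. *)
Lemma ereal_inf_series :
  ereal_inf [set ((k + N)%N%:R)%:E | k in [set k | Q k]] =
  (\sum_(0 <= m <oo)
    (`[< forall k, (k + N <= m)%N -> ~ Q k >]%:R : R)%:E)%E.
Proof.
set F := fun m => (`[< forall k, (k + N <= m)%N -> ~ Q k >]%:R : R).
have F0 m : (0 <= (F m)%:E)%E by rewrite lee_fin.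
have [[k0 Qk0]|nQ] := pselect (exists k, Q k); last first.
  rewrite [X in ereal_inf X](_ : _ = set0); last first.
    by apply/seteqP; split => // x [k Qk _]; apply: nQ; exists k.
  rewrite ereal_inf0; apply/esym/eq_infty => r.
  have F1 m : F m = 1.
    by rewrite /F; case: asboolP => // -[] k _ Qk; apply: nQ; exists k.
  pose n := Num.bound `|r|.
  apply: (@le_trans _ _ (\sum_(0 <= m < n) (F m)%:E)%E); last first.
    by apply: nneseries_lim_ge.
  rewrite sumEFin lee_fin (eq_bigr (fun=> 1)) => [|i _]; last exact: F1.
  rewrite big_const_nat iter_addr_0 subn0.
  by rewrite (le_trans (ler_norm r))// ltW// archi_boundP.
have exQ : exists k, `[< Q k >] by exists k0; apply/asboolP.
pose k := ex_minn exQ.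
have [Qk kmin] : Q k /\ forall j, Q j -> (k <= j)%N.
  rewrite /k; case: ex_minnP => m /asboolP Qm mmin.
  by split=> // j Qj; apply: mmin; apply/asboolP.
transitivity (((k + N)%N%:R : R)%:E).
  apply/eqP; rewrite eq_le; apply/andP; split.
    by apply: ereal_inf_lbound; exists k.
  apply: le_ereal_inf_tmp => _ [j Qj <-].
  by rewrite lee_fin ler_nat leq_add2r kmin.
(* For the least [k] in [Q], the indicator is 1 below [k + N] and 0 from there on. *)
rewrite (nneseries_split 0 (k + N))// add0n eseries0 ?adde0.
  rewrite sumEFin; congr EFin.
  rewrite (eq_big_nat _ _ (F2 := fun=> 1)); last first.
    move=> m /andP[_ mk]; rewrite /F; case: asboolP => // -[] j jm Qj.
    by have := kmin _ Qj; lia.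
  by rewrite big_const_nat iter_addr_0 subn0.
move=> m km _; rewrite /F; case: asboolP => // /(_ k km); tauto.
Qed.

End SeriesOfIndicators.

(** * Transfer from the random walk to binary words *)

Section WaitingTime.
Context (R : realType) d (T : measurableType d) (P : probability T R).
Variable RW : nat -> {RV P >-> R}.
Hypothesis hRW : simple_random_walk RW.

Let X k t : R := RW k.+1 t - RW k t.
(** Any increment other than 1 is coded as a down bit, so the word is defined everywhere, including
    on the null event where an increment is not +1 or -1. *)
Let bits k m t : seq bool := [seq X j t == 1 | j <- iota k m].

Let measurable_X k : measurable_fun setT (X k).
Proof. exact: measurable_funB. Qed.

Let measurable_X1 k (r : R) : measurable [set t | X k t = r].
Proof.
rewrite -[X in measurable X]setTI.
exact: (measurable_X k measurableT (measurable_set1 r)).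
Qed.

Let bitsSr k m t : bits k m.+1 t = rcons (bits k m t) (X (k + m) t == 1).
Proof. by rewrite /bits -addn1 iotaD map_cat cats1. Qed.

Let measurable_bits (B : pred (seq bool)) k m :
  measurable [set t | B (bits k m t)].
Proof.
elim: m B => [|m IHm] B.
  rewrite /bits/=; case: (B [::]).
    by rewrite [X in measurable X](_ : _ = setT)//; apply/seteqP.
  by rewrite [X in measurable X](_ : _ = set0)//; apply/seteqP; split.
rewrite [X in measurable X](_ : _ =
  ([set t | X (k + m) t = 1] `&` [set t | B (rcons (bits k m t) true)]) `|`
  (~` [set t | X (k + m) t = 1] `&` [set t | B (rcons (bits k m t) false)])).
  apply: measurableU; apply: measurableI.
  - exact: measurable_X1.
  - exact: (IHm (fun s => B (rcons s true))).
  - by apply: measurableC; exact: measurable_X1.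
  - exact: (IHm (fun s => B (rcons s false))).
apply/seteqP; split => t /=; rewrite bitsSr.
  by case: eqP => /= X1 BX; [left|right].
by case: eqP => /= X1 [[? ?]|[? ?]].
Qed.

Let prob_bit b k : P [set t | (X k t == 1) = b] = (2^-1)%:E.
Proof.
have -> : [set t | (X k t == 1) = b] =
    if b then [set t | X k t = 1] else ~` [set t | X k t = 1].
  by case: b; apply/seteqP; split => t /=; case: eqP.
case: b; first exact: (srw_up hRW).
by rewrite probability_setC// (srw_up hRW) -EFinB; congr EFin; lra.
Qed.

(** Mutual independence applied to the sets [B j], each being [[set 1]] or its complement. *)
Let prob_bits s : P [set t | bits 0 (size s) t = s] = (2^-1 ^+ size s)%:E.
Proof.
pose B j : set R := if nth false s j then [set 1] else ~` [set 1].
have mB j : measurable (B j).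
  by rewrite /B; case: ifP => _; first exact: measurable_set1;
    apply: measurableC; exact: measurable_set1.
have := srw_indep hRW [fset j in iota 0 (size s)]%fset mB.
rewrite (_ : \bigcap_(j in _) _ = [set t | bits 0 (size s) t = s]).
  move=> ->; rewrite (eq_bigr (fun=> (2^-1 : R)%:E)) => [|j _].
    rewrite prodEFin big_const_seq count_predT iter_mulr_1; congr (_ ^+ _)%:E.
    by rewrite card_fseq undup_id ?iota_uniq// size_iota.
  rewrite -(prob_bit (nth false s j) j); congr (P _).
  by rewrite /B; apply/seteqP; split => t /=; case: (nth _ _ _) => /=;
    case: eqP.
have nth_bits t j : (j < size s)%N ->
    nth false (bits 0 (size s) t) j = (X j t == 1).
  by move=> js; rewrite (nth_map 0%N) ?size_iota// nth_iota.
apply/seteqP; split => t /= H.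
  apply: (@eq_from_nth _ false); first by rewrite size_map size_iota.
  move=> j; rewrite size_map size_iota => js; rewrite nth_bits//.
  have := H j; rewrite /= in_fset mem_iota/= js => /(_ isT).
  by rewrite /B; case: (nth _ _ _) => /= XE; apply/eqP.
move=> j /=; rewrite in_fset mem_iota/= => js.
by rewrite /B -[in nth _ s]H nth_bits//; case: eqP.
Qed.

(** New bits are appended on the right while [avg] consumes letters from the left; fixing a prefix
    [s] that grows bit by bit reconciles the two. *)
Let prob_bits_cat m s (B : pred (seq bool)) :
  P [set t | bits 0 (size s) t = s /\ B (bits 0 (size s + m) t)] =
  (2^-1 ^+ size s * prob R m (fun z => B (s ++ z)))%:E.
Proof.
elim: m s => [|m IHm] s.
  rewrite addn0 /prob/= cats0; case Bs : (B s).
    rewrite mulr1 -prob_bits; congr (P _); apply/seteqP.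
    by split => t /=; [case|move=> ->].
  rewrite mulr0 -[RHS](@measure0 _ _ _ P); congr (P _); apply/seteqP.
  by split => t //= -[->]; rewrite Bs.
pose E b := [set t | bits 0 (size s).+1 t = rcons s b /\
                    B (bits 0 (size s + m.+1) t)].
have IHr b : P (E b) =
    (2^-1 ^+ (size s).+1 * prob R m (fun z => B (rcons s b ++ z)))%:E.
  by rewrite -(size_rcons s b) -IHm size_rcons addSnnS.
have mE b : measurable (E b).
  rewrite [X in measurable X](_ : _ =
    [set t | pred1 (rcons s b) (bits 0 (size s).+1 t)] `&`
    [set t | B (bits 0 (size s + m.+1) t)]); first exact: measurableI.
  by apply/seteqP; split => t /= [/eqP ? ?]; split => //; apply/eqP.
rewrite (_ : [set t | _] = E true `|` E false).
  rewrite measureU//; last first.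
    apply/seteqP; split => t // -[[E1 _] [E2 _]].
    by move: E1; rewrite E2 => /rcons_inj[].
  rewrite [X in (X + _)%E]IHr [X in (_ + X)%E]IHr -EFinD; congr EFin.
  have catr b : prob R m (fun z => B (rcons s b ++ z)) =
      prob R m (fun z => B (s ++ b :: z)).
    by apply: eq_prob => z _; rewrite cat_rcons.
  by rewrite !catr probS exprSr; lra.
apply/seteqP; split => t /=; rewrite /E/= bitsSr.
  by move=> [-> Bt]; case: (X _ t == 1); [left|right].
by move=> [] [/rcons_inj[-> _]].
Qed.

Let prob_bitsE m (B : pred (seq bool)) :
  P [set t | B (bits 0 m t)] = (prob R m B)%:E.
Proof.
rewrite -[prob _ _ _]mul1r -(prob_bits_cat m [::] B); congr (P _).
by apply/seteqP; split => t //= -[].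
Qed.

Let fair t := forall k, X k t = 1 \/ X k t = -1.

(** A countable union of null events, since 1/2 + 1/2 = 1 for each increment. *)
Let unfair0 : P (~` fair) = 0 /\ measurable (~` fair : set T).
Proof.
pose F k := ~` ([set t | X k t = 1] `|` [set t | X k t = -1]).
have mF k : measurable (F k) by apply: measurableC; exact: measurableU.
have -> : ~` fair = \bigcup_k F k.
  apply/seteqP; split => t /=; first by move/existsNP => [k Xk]; exists k.
  by move=> [k _ Xk] /(_ k).
split; last exact: bigcup_measurable.
apply/eqP; rewrite -measure_le0.
apply: le_trans (generalized_Boole_inequality _ mF _) _.
  exact: bigcup_measurable.
have PU k : P ([set t | X k t = 1] `|` [set t | X k t = -1]) = 1%E.
  rewrite measureU//.
    rewrite [X in (X + _)%E](srw_up hRW k) [X in (_ + X)%E](srw_down hRW k).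
    by rewrite -EFinD; congr EFin; lra.
  by apply/seteqP; split => t //= -[->]; lra.
rewrite eseries0// => k _ _; rewrite /= /F probability_setC ?PU ?subee//.
exact: measurableU.
Qed.

Let eq_prob_fair (E F : set T) : measurable E -> measurable F ->
  (forall t, fair t -> E t <-> F t) -> P E = P F.
Proof.
have [PN0 mN] := unfair0.
suff le E1 F1 : measurable E1 -> measurable F1 ->
    (forall t, fair t -> E1 t -> F1 t) -> (P E1 <= P F1)%E.
  by move=> mE mF EF; apply/eqP; rewrite eq_le !le// => t /EF[].
move=> mE mF EF; rewrite -(measureU0 mF mN PN0).
apply: le_measure; rewrite ?inE//; first exact: measurableU.
move=> t Et; have [/EF ft|nft] := pselect (fair t); last by right.
by left; exact: ft.
Qed.

Variables (N : nat) (A : set (path_of R N)) (A' : pred (seq bool)).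
Hypothesis N0 : (0 < N)%N.
Hypothesis AA' : encodes A' A.

Let occ k t := A (fun i : 'I_N.+1 => RW (k + i)%N t - RW k t).

Let occE k t : occ k t <->
  (forall i, (i < N)%N -> X (k + i) t = 1 \/ X (k + i) t = -1) /\
  A' (bits k N t).
Proof.
rewrite /occ AA'; split=> [[s [szs As ws]]|[Xpm Ab]].
  have stepE i : (i < N)%N -> X (k + i) t = (step (nth false s i))%:~R.
    move=> iN; have := ws (Ordinal (ltnW iN : i < N.+1)%N).
    have := ws (Ordinal (iN : i.+1 < N.+1)%N).
    rewrite /= hgt_take_nth ?szs// intrD addnS /X; lra.
  have -> : bits k N t = s.
    apply: (@eq_from_nth _ false); first by rewrite size_map size_iota.
    move=> i; rewrite size_map size_iota => iN.
    rewrite (nth_map 0%N) ?size_iota// nth_iota// stepE//.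
    by case: (nth _ _ _); rewrite /step ?eqxx//; apply/eqP; lra.
  split=> // i /stepE ->; case: (nth _ _ _); [by left|right].
  by rewrite /step mulrN1z.
have szb : size (bits k N t) = N by rewrite size_map size_iota.
exists (bits k N t); split=> // -[i /= iN].
elim: i iN => [|i IHi] iN; first by rewrite take0 hgt_nil addn0 subrr.
rewrite hgt_take_nth ?szb// intrD -IHi ?(ltnW iN)// (nth_map 0%N) ?size_iota//.
rewrite nth_iota// addnS.
have := Xpm i iN; rewrite /X => -[] XE; rewrite XE.
  by rewrite eqxx /step; lra.
by rewrite (_ : -1 == 1 = false) /step ?mulrN1z; [lra|apply/eqP; lra].
Qed.

Let measurable_occ k : measurable (occ k).
Proof.
rewrite [X in measurable X](_ : _ =
  (\bigcap_(i in [set i | (i < N)%N])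
     ([set t | X (k + i) t = 1] `|` [set t | X (k + i) t = -1])) `&`
  [set t | A' (bits k N t)]).
  apply: measurableI => //; apply: bigcap_measurableType => i _.
  exact: measurableU.
by apply/seteqP; split => t /occE.
Qed.

Let none m := [set t | forall k, (k + N <= m)%N -> ~ occ k t].

Let measurable_none m : measurable (none m).
Proof.
rewrite [X in measurable X](_ : _ =
  \bigcap_(k in [set k | (k + N <= m)%N]) ~` occ k).
  by apply: bigcap_measurableType => k _; exact: measurableC.
by apply/seteqP; split.
Qed.

(** Almost surely all increments are +1 or -1, and then an occurrence in the walk is an occurrence
    in its word. *)
Let prob_none m : P (none m) = (survival R N A' m)%:E.
Proof.
rewrite -prob_bitsE; apply: eq_prob_fair => // t ft.
have windowE k : (k + N <= m)%N -> take N (drop k (bits 0 m t)) = bits k N t.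
  move=> kN; rewrite /bits -map_drop -map_take drop_iota take_iota add0n.
  by congr (map _ (iota _ _)); lia.
have szb : size (bits 0 m t) = m by rewrite size_map size_iota.
split=> [nt|/avoidP H k kN].
  apply/avoidP => k; rewrite szb => kN; rewrite windowE//.
  by apply/negP => Ab; apply: (nt k kN); apply/occE; split.
move=> /occE[_]; rewrite -windowE//; apply/negP; apply: H.
by rewrite szb.
Qed.

(** The tail formula for E T: the integral of the series of indicators is taken term by term, as
    they are nonnegative. *)
Theorem expected_waiting_timeE :
  expected_waiting_time RW A =
  (\sum_(0 <= m <oo) (survival R N A' m)%:E)%E.
Proof.
rewrite /expected_waiting_time.
under eq_integral do rewrite /waiting_time ereal_inf_series.
rewrite integral_nneseries//.
- apply: eq_eseriesr => m _.
  transitivity (\int[P]_t (\1_(none m) t)%:E)%E; last first.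
    by rewrite integral_indic// setIT; exact: prob_none.
  by apply: eq_integral => t _; rewrite indicE.
- move=> m; apply/measurable_EFinP.
  apply: (eq_measurable_fun (\1_(none m) : T -> R)); last first.
    exact: measurable_indic.
  by move=> t _; rewrite indicE.
Qed.

End WaitingTime.

(** * Pattern classes as sets of words *)

(* The path started at height [x] hits [0] for the first time at its end. *)
Fixpoint passage (x : int) (s : seq bool) : bool :=
  if s is b :: s' then (0 < x) && passage (x + step b) s' else x == 0.

Fixpoint stays (x : int) (s : seq bool) : bool :=
  (0 < x) && (if s is b :: s' then stays (x + step b) s' else true).

Lemma passageP x s :
  reflect (x + hgt s = 0 /\
           forall i, (i < size s)%N -> 0 < x + hgt (take i s))
          (passage x s).
Proof.
elim: s x => [|b s IHs] x /=.
  by rewrite hgt_nil addr0; apply: (iffP eqP) => [|[]].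
apply: (iffP andP) => [[x0 /IHs[Hs Hi]]|[Hs Hi]].
  split=> [|[|i] ilt]; first by rewrite hgt_cons addrA.
    by rewrite take0 hgt_nil addr0.
  by rewrite /= hgt_cons addrA; exact: Hi.
split; first by have := Hi 0%N isT; rewrite take0 hgt_nil addr0.
apply/IHs; split=> [|i ilt]; first by rewrite -addrA -hgt_cons.
by have := Hi i.+1 ilt; rewrite /= hgt_cons addrA.
Qed.

Lemma staysP x s :
  reflect (forall i, (i <= size s)%N -> 0 < x + hgt (take i s)) (stays x s).
Proof.
elim: s x => [|b s IHs] x /=.
  rewrite andbT; apply: (iffP idP) => [x0 i _|/(_ 0%N isT)];
    by rewrite hgt_nil addr0.
apply: (iffP andP) => [[x0 /IHs Hi] [|i] ilt|Hi].
- by rewrite take0 hgt_nil addr0.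
- by rewrite /= hgt_cons addrA; exact: Hi.
split; first by have := Hi 0%N isT; rewrite take0 hgt_nil addr0.
by apply/IHs => i ilt; have := Hi i.+1 ilt; rewrite /= hgt_cons addrA.
Qed.

(** The height at the junction may be 0 only if nothing follows, hence the separate case of an empty
    [z]. *)
Lemma passage_cat x s z :
  passage x (s ++ z) = if z is [::] then passage x s
                       else stays x s && passage (x + hgt s) z.
Proof.
case: z => [|c z]; first by rewrite cats0.
elim: s x => [|b s IHs] x /=.
  by rewrite hgt_nil addr0 andbT; case: (0 < x).
by rewrite IHs hgt_cons addrA andbA.
Qed.

Lemma stays_cat x s z : stays x (s ++ z) -> stays x s.
Proof.
move=> /staysP H; apply/staysP => i ilt; have := H i.
by rewrite size_cat takel_cat// => -> //; lia.
Qed.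

Lemma stays_gt0 x s : stays x s -> 0 < x + hgt s.
Proof. by move=> /staysP/(_ (size s) (leqnn _)); rewrite take_size. Qed.

Lemma passage_stays_cat x y s z : y <= x -> passage x s -> ~~ stays y (s ++ z).
Proof.
move=> yx /passageP[xs _]; apply/negP => /stays_cat/stays_gt0; lia.
Qed.

(** The path starts at 0, which is not positive, so the forced first up step is stripped before
    using [passage] from height 1; likewise for meanders with [stays]. *)
Definition excursion_word (s : seq bool) : bool :=
  if s is true :: s' then passage 1 s' else false.

Definition meander_word (s : seq bool) : bool :=
  if s is true :: s' then stays 1 s' else false.

Section Encodings.
Variable R : realType.

Definition word_path N (s : seq bool) : path_of R N :=
  fun i => (hgt (take i s))%:~R.
Arguments word_path : clear implicits.

Lemma SW_word_path N s : size s = N -> SW R N (word_path N s).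
Proof.
move=> szs; split; first by rewrite /word_path take0 hgt_nil.
move=> i j ji; rewrite /word_path ji hgt_take_nth; last first.
  by rewrite szs -ltnS -ji.
rewrite -intrB addrC addKr; case: (nth _ _ _); [by left|right].
by rewrite mulrN1z.
Qed.

Lemma SW_words N (w : path_of R N) : SW R N w ->
  exists2 s, size s = N & w = word_path N s.
Proof.
move=> [w0 wS].
pose s := mkseq (fun i => w (inord i.+1) - w (inord i) == 1) N.
exists s; first by rewrite size_mkseq.
apply/funext => -[i iN]; rewrite /word_path /=.
elim: i iN => [|i IHi] iN.
  by rewrite take0 hgt_nil -[RHS]w0; congr w; exact: val_inj.
have iN' : (i < N)%N by [].
rewrite hgt_take_nth ?size_mkseq// intrD -(IHi (ltnW iN)) nth_mkseq//.
have -> : inord i.+1 = Ordinal iN by apply: val_inj; rewrite /= inordK.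
have -> : inord i = Ordinal (ltnW iN : i < N.+1)%N.
  by apply: val_inj; rewrite /= inordK// ltnW.
have [wE|wE] := wS (Ordinal (ltnW iN : i < N.+1)%N) (Ordinal iN) erefl.
  by rewrite wE eqxx /step; lra.
rewrite wE (_ : -1 == 1 = false) /step ?mulrN1z; first by lra.
by apply/eqP; lra.
Qed.

Lemma SW_encodes N (A : set (path_of R N)) (A' : pred (seq bool)) :
  (forall w, A w -> SW R N w) ->
  (forall s, size s = N -> A (word_path N s) <-> A' s) -> encodes A' A.
Proof.
move=> ASW AA' w; split=> [Aw|[s [szs As ws]]].
  have [s szs ws] := SW_words (ASW _ Aw).
  by exists s; split=> //; [apply/AA'; rewrite // -ws|move=> i; rewrite ws].
by rewrite (_ : w = word_path N s); [apply/AA'|apply/funext].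
Qed.

Lemma encodes_bridges lam n :
  encodes (fun s => hgt s == lambda_int lam n) (@bridges R lam n).
Proof.
apply: SW_encodes => [w []//|s szs].
rewrite /bridges /= {2}/word_path take_oversize ?szs//.
split=> [[_ /intr_inj ->]//|/eqP ->].
by split; first exact: SW_word_path.
Qed.

(** Shifting the path up by [- lambda_int lam n] turns its final minimum into a first visit to 0. *)
Lemma encodes_first_passages lam n :
  encodes (passage (- lambda_int lam n)) (@first_passages R lam n).
Proof.
apply: SW_encodes => [w []//|s szs].
have maxE : word_path n s ord_max = (hgt s)%:~R.
  by rewrite /word_path take_oversize ?szs.
rewrite /first_passages/= maxE; split.
  move=> [_ wi /intr_inj hs]; apply/passageP; split; first by rewrite hs addNr.
  move=> i; rewrite szs => ilt.
  have := wi (Ordinal (ltnW ilt : i < n.+1)%N) ilt.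
  by rewrite /word_path ltr_int/= hs; lia.
move=> /passageP[hs wi]; have -> : lambda_int lam n = hgt s by lia.
split=> //; first exact: SW_word_path.
move=> i ilt; rewrite /word_path ltr_int.
by have := wi i; rewrite szs => /(_ ilt); lia.
Qed.

(** For [n = 0] the trivial path is in [excursions R 0], but the empty word is not an
    [excursion_word]. *)
Lemma encodes_excursions n : (0 < n)%N ->
  encodes excursion_word (excursions R n).
Proof.
move=> n0; apply: SW_encodes => [w []//|s szs].
rewrite /excursions /= {3}/word_path take_oversize ?szs//.
case: s szs => [|b s] szs; first by move: szs => /=; lia.
split=> [[_ wi]|].
  rewrite hgt_cons -[RHS]/(0%:~R) => /intr_inj hs.
  have b1 : b = true.
    have i1 : (1 < (2 * n).+1)%N by lia.
    have /= := wi (Ordinal i1); rewrite /word_path /= take0 hgt_cons hgt_nil.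
    by case: b {szs wi hs} => // /(_ ltac:(lia)); rewrite /step; lra.
  rewrite b1 /=; apply/passageP; split; first by rewrite -hs b1.
  move=> i ilt; have i1 : (i.+1 < (2 * n).+1)%N by move: szs => /=; lia.
  have /= := wi (Ordinal i1); rewrite /word_path /= hgt_cons b1 ltr0z; apply.
  by move: szs => /=; lia.
case: b szs => // szs /passageP[hs wi].
split; [exact: SW_word_path| |by rewrite hgt_cons hs].
move=> [[|i] i1] //= ilt; rewrite /word_path /= hgt_cons ltr0z; apply: wi.
by move: szs => /=; lia.
Qed.

Lemma encodes_meanders n : encodes meander_word (meanders R n).
Proof.
apply: SW_encodes => [w []//|s szs].
rewrite /meanders /=.
case: s szs => [|b s] szs; first by move: szs => /=; lia.
split=> [[_ wi]|].
  have b1 : b = true.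
    have i1 : (1 < (2 * n + 1).+1)%N by lia.
    have /= := wi (Ordinal i1); rewrite /word_path /= take0 hgt_cons hgt_nil.
    by case: b {szs wi} => // /(_ ltac:(lia)); rewrite /step; lra.
  rewrite b1 /=; apply/staysP.
  move=> i ilt; have i1 : (i.+1 < (2 * n + 1).+1)%N by move: szs => /=; lia.
  have /= := wi (Ordinal i1); rewrite /word_path /= hgt_cons b1 ltr0z; apply.
  by move: szs => /=; lia.
case: b szs => // szs /staysP wi.
split; first exact: SW_word_path.
move=> [[|i] i1] //= ilt; rewrite /word_path /= hgt_cons ltr0z; apply: wi.
by move: szs => /=; lia.
Qed.

End Encodings.

(** * Point and first passage probabilities *)

Section PointProbabilities.
Variable R : realType.

Definition point_prob n (x : int) : R := prob R n (fun s => hgt s == x).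
Definition passage_prob n (x : int) : R := prob R n (passage x).

Local Notation q := point_prob.
Local Notation h := passage_prob.

Lemma point_prob0 x : q 0 x = (x == 0)%:R.
Proof. by rewrite /q /prob /= hgt_nil eq_sym. Qed.

Lemma point_probS n x : q n.+1 x = (q n (x - 1) + q n (x + 1)) / 2.
Proof.
rewrite /q probS; congr ((_ + _) / 2); apply: eq_prob => s _;
  rewrite hgt_cons /step; lia.
Qed.

Lemma point_prob_ge0 n x : 0 <= q n x. Proof. exact: prob_ge0. Qed.

Lemma passage_prob_ge0 n x : 0 <= h n x. Proof. exact: prob_ge0. Qed.

Lemma passage_prob0 x : h 0 x = (x == 0)%:R.
Proof. by []. Qed.

Lemma passage_probS n x : 0 < x -> h n.+1 x = (h n (x - 1) + h n (x + 1)) / 2.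
Proof.
move=> x0; rewrite /h probS addrC; congr ((_ + _) / 2); apply: eq_prob => s _;
  by rewrite /= x0.
Qed.

Lemma passage_prob_le0 n x : x <= 0 -> h n.+1 x = 0.
Proof. by move=> x0; apply: prob0 => -[|b s] //= _; lia. Qed.

Lemma point_probN n x : q n (- x) = q n x.
Proof.
elim: n x => [|n IHn] x; first by rewrite !point_prob0 oppr_eq0.
rewrite !point_probS addrC -(IHn (x - 1)) -(IHn (x + 1)).
by congr ((q n _ + q n _) / 2); lia.
Qed.

Lemma point_prob_parity n x : (x != n%:Z %[mod 2])%Z -> q n x = 0.
Proof.
elim: n x => [|n IHn] x xn; first by rewrite point_prob0; case: eqP => //; lia.
by rewrite point_probS !IHn ?addr0 ?mul0r//; lia.
Qed.

(** The ratio of neighbouring binomial coefficients, cross-multiplied so that it also covers the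
    wrong parity and the edges of the support. *)
Lemma point_prob_ratio n x :
  (n%:R + 1 - x%:~R) * q n (x - 1) = (n%:R + 1 + x%:~R) * q n (x + 1).
Proof.
elim: n x => [|n IHn] x.
  rewrite !point_prob0; case: eqP => [?|_].
    have -> : x = 1 by lia.
    by rewrite /= mulr0; lra.
  case: eqP => [?|_]; last by rewrite !mulr0.
  have -> : x = -1 by lia.
  by rewrite mulrN1z mulr0; lra.
rewrite !point_probS.
have := IHn (x - 1); have := IHn (x + 1).
rewrite !(addrK, subrK) !intrD !mulrN1z -[n.+1%:R]/(n.+1%:R) mulrS.
move: (q n _) (q n _) (q n x) => a b c Ha Hb.
(* Both sides of the goal equal [(n + 1) * q n x], by the two instances of the induction
   hypothesis. *)
have -> : (1 + n%:R + 1 - x%:~R) * ((a + c) / 2) = (n%:R + 1) * c :> R by lra.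
lra.
Qed.

(** The reflection principle. The right-hand side obeys the recursion of [passage_probS] and
    vanishes at 0 by symmetry of [q n]. *)
Lemma passage_prob_reflection n x :
  0 <= x -> h n.+1 x = (q n (x - 1) - q n (x + 1)) / 2.
Proof.
elim: n x => [|n IHn] x; rewrite le_eqVlt => /predU1P[<-|x0].
- by rewrite passage_prob_le0// sub0r add0r point_probN subrr mul0r.
- rewrite passage_probS// !passage_prob0 !point_prob0.
  rewrite (_ : (x + 1 == 0) = false) ?addr0 ?subr0//; lia.
- by rewrite passage_prob_le0// sub0r add0r point_probN subrr mul0r.
rewrite passage_probS// !IHn ?point_probS; [|lia|lia].
by rewrite !(addrK, subrK); lra.
Qed.

(** With the reflection formula and a first-step expansion of [q n.+1 x], this becomes
    [point_prob_ratio]. *)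
Lemma hitting_time_theorem n x : 0 <= x -> n%:R * h n x = x%:~R * q n x.
Proof.
case: n => [|n] x0.
  by rewrite point_prob0 mul0r; case: eqP => [->|_]; rewrite ?mul0r ?mulr0.
rewrite passage_prob_reflection// point_probS.
have := point_prob_ratio n x; rewrite mulrS; lra.
Qed.

Lemma point_prob_unimodal n x : -1 <= x -> q n (x + 2) <= q n x.
Proof.
move=> x1; have := point_prob_ratio n (x + 1).
rewrite addrK (_ : x + 1 + 1 = x + 2) => [Hr|]; last by lia.
have y0 : 0 <= (x + 1)%:~R :> R by rewrite ler0z; lia.
have n0 : 0 <= n%:R :> R by [].
rewrite -(@ler_pM2l _ (n%:R + 1 + (x + 1)%:~R)); last by lra.
rewrite -Hr ler_wpM2r ?point_prob_ge0//; lra.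
Qed.

(** By unimodality each of the [k + 1] points [x, x + 2, ..., x + 2k] has at least the probability
    of the last one. *)
Lemma point_prob_mass n k x : 0 <= x ->
  k.+1%:R * q n (x + (2 * k)%N%:Z) <=
  prob R n (fun s => hgt s <= x + (2 * k)%N%:Z).
Proof.
move=> x0; elim: k => [|k IHk].
  by rewrite mul1r; apply: ler_prob => s _ /eqP ->.
have yE : x + (2 * k.+1)%N%:Z = x + (2 * k)%N%:Z + 2 by lia.
rewrite yE; set y := x + (2 * k)%N%:Z in IHk *.
apply: (@le_trans _ _ (prob R n (fun s => hgt s <= y) + q n (y + 2))).
  rewrite mulrSr mulrDl mul1r lerD2r; apply: le_trans IHk.
  by rewrite ler_wpM2l//; apply: point_prob_unimodal; rewrite /y; lia.
rewrite -avgD; apply: ler_avg => s _.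
have [->|_] := eqVneq (hgt s) (y + 2).
  by rewrite lexx (_ : (y + 2 <= y) = false) ?add0r//; lia.
rewrite addr0 ler_nat; case: (leP (hgt s) y) => // sy.
by rewrite (_ : hgt s <= y + 2)//; lia.
Qed.

(** At least [x / 2] nonnegative points of the parity of [x], up to [x] itself, are at least as
    likely as [x], and their total mass is at most 1. *)
Lemma point_prob_first_moment n x : 0 <= x -> x%:~R * q n x <= 2.
Proof.
move=> x0.
have x2 : 0 <= (x %% 2)%Z by lia.
have := @point_prob_mass n `|(x %/ 2)%Z|%N (x %% 2)%Z x2.
have -> : (x %% 2)%Z + (2 * `|(x %/ 2)%Z|)%N%:Z = x by lia.
move=> /le_trans/(_ (prob_le1 _ _ _)) H.
have : x%:~R <= 2 * `|(x %/ 2)%Z|.+1%:R :> R.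
  by rewrite -[2]/(2%:~R) -natrM -[(2 * _)%N%:R]/((2 * _)%N%:~R) ler_int; lia.
have := point_prob_ge0 n x.
move: (q n x) (_.+1%:R : R) H => a b ab a0 xb.
apply: (@le_trans _ _ (2 * b * a)); first by rewrite ler_wpM2r.
lra.
Qed.

(** Uniform in [x], as required for overlaps, where the starting level depends on the first
    pattern. *)
Lemma passage_prob_le n x : (0 < n)%N -> h n x <= 2 / n%:R.
Proof.
move=> n0; have nR : 0 < n%:R :> R by rewrite ltr0n.
have [x0|x0] := ltP x 0.
  by case: n n0 nR => // n _ nR; rewrite passage_prob_le0 ?divr_ge0//; lia.
rewrite ler_pdivlMr// mulrC hitting_time_theorem//.
exact: point_prob_first_moment.
Qed.

Definition return_prob n : R := q (2 * n) 0.
Local Notation u := return_prob.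

Lemma return_prob0 : u 0 = 1.
Proof. by rewrite /u muln0 point_prob0 eqxx. Qed.

Lemma point_prob_odd1 n : q (2 * n).+1 1 = u n.+1.
Proof.
rewrite /u (_ : (2 * n.+1 = (2 * n).+2)%N); last by lia.
by rewrite [RHS]point_probS sub0r add0r point_probN; lra.
Qed.

Lemma return_probS n : u n.+1 = (2 * n%:R + 1) / (2 * n%:R + 2) * u n.
Proof.
rewrite -point_prob_odd1 point_probS subrr.
have := point_prob_ratio (2 * n) 1; rewrite subrr natrM /=.
rewrite -/(u n); move: (q _ _) => a Ha.
have n0 : 0 <= n%:R :> R by [].
have -> : a = 2 * n%:R / (2 * n%:R + 2) * u n.
  apply: (@mulfI _ (2 * n%:R + 2)); first by lra.
  rewrite mulrA [_ * (_ / _)]mulrC divfK; lra.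
by field; lra.
Qed.

Lemma return_prob_gt0 n : 0 < u n.
Proof.
elim: n => [|n IHn]; first by rewrite return_prob0.
have n0 : 0 <= n%:R :> R by [].
by rewrite return_probS mulr_gt0// divr_gt0//; lra.
Qed.

(** The squared fraction is [(u n.+1 / u n) ^+ 2] at [a = n]. This bound makes [n * u n ^+ 2]
    nondecreasing; the next one makes [(2 * n + 1) * u n ^+ 2] nonincreasing. *)
Lemma wallis_ratio_ge (a : R) :
  0 <= a -> a <= (a + 1) * ((2 * a + 1) / (2 * a + 2)) ^+ 2.
Proof.
move=> a0; rewrite expr_div_n mulrA ler_pdivlMr; last by nra.
nra.
Qed.

Lemma wallis_ratio_le (a : R) :
  0 <= a -> (2 * (a + 1) + 1) * ((2 * a + 1) / (2 * a + 2)) ^+ 2 <= 2 * a + 1.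
Proof.
move=> a0; rewrite expr_div_n mulrA ler_pdivrMr; last by nra.
nra.
Qed.

Lemma return_prob_mono n : n%:R * u n ^+ 2 <= n.+1%:R * u n.+1 ^+ 2.
Proof.
rewrite return_probS exprMn mulrSr.
have := ler_wpM2r (sqr_ge0 (u n)) (wallis_ratio_ge (ler0n R n)); lra.
Qed.

Lemma return_prob_ge n : (0 < n)%N -> 1 <= 4 * n%:R * u n ^+ 2.
Proof.
case: n => // n _; elim: n => [|n IHn].
  by rewrite return_probS return_prob0 mulr0 add0r add0r mulr1; lra.
by apply: le_trans IHn _; have := return_prob_mono n.+1; lra.
Qed.

Lemma return_prob_le n : (2 * n%:R + 1) * u n ^+ 2 <= 1.
Proof.
elim: n => [|n IHn]; first by rewrite return_prob0 mulr0 add0r expr1n mulr1.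
apply: le_trans IHn; rewrite return_probS exprMn mulrSr.
have := ler_wpM2r (sqr_ge0 (u n)) (wallis_ratio_le (ler0n R n)); lra.
Qed.

(** The induction step is the recursion [(2n + 1) u n = (2n + 2) u n.+1]. *)
Lemma sum_return_prob n : \sum_(0 <= i < n) u i = 2 * n%:R * u n.
Proof.
elim: n => [|n IHn]; first by rewrite big_nil mulr0 mul0r.
rewrite big_nat_recr//= IHn return_probS mulrSr.
by have n0 : 0 <= n%:R :> R by []; field; lra.
Qed.

(** Add the hitting time identity, with right side [(q n 0 + q n 2) / 2], to the reflection formula
    [(q n 0 - q n 2) / 2]. *)
Lemma passage_prob1 n : n.+2%:R * h n.+1 1 = q n 0.
Proof.
have := @hitting_time_theorem n.+1 1 isT.
rewrite passage_prob_reflection// point_probS subrr.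
rewrite -[n.+2%:R]natr1 -[n.+1%:R]natr1; lra.
Qed.

Lemma passage_prob_odd1 n : h (2 * n).+1 1 = u n.+1 / (2 * n%:R + 1).
Proof.
have := @hitting_time_theorem (2 * n).+1 1 isT.
rewrite point_prob_odd1 mul1r => <-; rewrite mulrSr natrM.
by have n0 : 0 <= n%:R :> R by []; field; lra.
Qed.

(** The walk from 1 stays positive for [2 * n] steps with probability [u n]: odd terms telescope
    through [h (2 * n).+1 1 = u n - u n.+1], even ones vanish by parity. *)
Lemma sum_passage_prob n : \sum_(0 <= j < (2 * n).+1) h j 1 = 1 - u n.
Proof.
elim: n => [|n IHn]; first by rewrite muln0 big_nat1 return_prob0 subrr.
rewrite (_ : (2 * n.+1).+1 = (2 * n).+3); last by lia.
rewrite big_nat_recr//= big_nat_recr//= IHn passage_prob_odd1.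
rewrite passage_prob_reflection// !point_prob_parity; [|lia|lia].
rewrite return_probS subrr mul0r.
by have n0 : 0 <= n%:R :> R by []; field; lra.
Qed.

(** Truncated mean excursion length; the weight [j.+1] includes the initial up step. *)
Lemma sum_passage_prob_mean n :
  \sum_(0 <= j < (2 * n).+1) j.+1%:R * h j 1 = 2 * n%:R * u n.
Proof.
rewrite big_nat_recl// passage_prob0 mulr0 add0r -sum_return_prob.
under eq_bigr do rewrite passage_prob1.
elim: n => [|n IHn]; first by rewrite muln0 !big_nil.
rewrite (_ : (2 * n.+1) = (2 * n).+2)%N; last by lia.
rewrite big_nat_recr//= big_nat_recr//= [RHS]big_nat_recr//= IHn.
rewrite [q (2 * n).+1 0]point_prob_parity; last by lia.
by rewrite addr0.
Qed.

(** Symmetry and unimodality reduce to the mode, 0 or 1 according to parity, where [return_prob_le]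
    applies. *)
Lemma point_prob_le n x : n.+1%:R * q n x ^+ 2 <= 1.
Proof.
wlog x0 : x / 0 <= x => [wl|].
  have [x0|x0] := leP 0 x; first exact: wl.
  by rewrite -point_probN; apply: wl; lia.
have qle (y : int) k : -1 <= y -> q n (y + (2 * k)%N%:Z) <= q n y.
  move=> y1; elim: k => [|k]; first by rewrite addr0.
  apply: le_trans.
  rewrite (_ : (2 * k.+1)%N%:Z = (2 * k)%N%:Z + 2); last by lia.
  by rewrite addrA point_prob_unimodal//; lia.
have {qle} q_mod2 : q n x <= q n (x %% 2)%Z.
  have := qle (x %% 2)%Z `|(x %/ 2)%Z|%N.
  have -> : (x %% 2)%Z + (2 * `|(x %/ 2)%Z|)%N%:Z = x by lia.
  by apply; lia.
have [xn|xn] := boolP (x == n%:Z %[mod 2])%Z; last first.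
  by rewrite point_prob_parity// expr0n mulr0.
apply: (@le_trans _ _ (n.+1%:R * q n (x %% 2)%Z ^+ 2)).
  by rewrite ler_wpM2l// ler_pXn2r ?nnegrE ?point_prob_ge0.
have := odd_double_half n; case: (boolP (odd n)) => /= on nE.
  have -> : (x %% 2)%Z = 1 by lia.
  have n2 : n = (2 * n./2).+1 by lia.
  rewrite n2 point_prob_odd1; apply: le_trans (return_prob_le n./2.+1).
  rewrite ler_wpM2r ?sqr_ge0// -[2]/(2%:R) -natrM natr1 ler_nat; lia.
have -> : (x %% 2)%Z = 0 by lia.
have n2 : n = (2 * n./2)%N by lia.
rewrite n2; apply: le_trans (return_prob_le n./2).
by rewrite ler_wpM2r ?sqr_ge0// -[2]/(2%:R) -natrM natr1.
Qed.

End PointProbabilities.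

(** * Local lower bound at scale sqrt(n), and sums of inverse powers *)

Section LocalLowerBound.
Variable R : realType.
Local Notation q := (point_prob R).

Lemma sqrt_natK n : Num.sqrt n%:R ^+ 2 = n%:R :> R.
Proof. by rewrite sqr_sqrtr. Qed.

Lemma near_sqrt_ge (r : R) : \forall n \near \oo, r <= Num.sqrt n%:R.
Proof.
near=> n; have [r0|/ltW r0] := leP r 0; first by rewrite (le_trans r0).
rewrite -(ger0_norm r0) -sqrtr_sqr ler_wsqrtr//.
by near: n; exact: nbhs_infty_ger.
Unshelve. all: by end_near. Qed.

(** From [1 + 2y <= expR (2y)] and [1 <= (1 - y) (1 + 2y)] on this range. *)
Lemma expR_le_1B (y : R) : 0 <= y <= 2^-1 -> expR (- (2 * y)) <= 1 - y.
Proof.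
move=> /andP[y0 y1]; rewrite expRN -div1r ler_pdivrMr ?expR_gt0//.
have := expR_ge1Dx (2 * y); nra.
Qed.

Lemma point_prob_mod2_ge n : (0 < n)%N ->
  2^-1 <= Num.sqrt n%:R * q n (odd n)%:Z.
Proof.
move=> n0; set s := Num.sqrt _; set p := q _ _.
have p0 : 0 <= p := point_prob_ge0 _ _ _.
have s0 : 0 <= s by exact: sqrtr_ge0.
have sE : s ^+ 2 = n%:R by exact: sqrt_natK.
suff : 1 <= 4 * s ^+ 2 * p ^+ 2.
  by rewrite -mulrA -exprMn; have := mulr_ge0 s0 p0; move: (s * p) => x; nra.
rewrite sE; have := odd_double_half n; rewrite /p; case: (odd n) => /= nE.
  have n2 : n = (2 * n./2).+1 by lia.
  rewrite [X in q X _]n2 point_prob_odd1.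
  apply: le_trans (return_prob_ge R (ltn0Sn n./2)) _.
  by rewrite ler_wpM2r ?sqr_ge0// ler_wpM2l// ler_nat; lia.
have n2 : n = (2 * n./2)%N by lia.
rewrite [X in q X _]n2 -/(return_prob R n./2).
have m0 : (0 < n./2)%N by lia.
apply: le_trans (return_prob_ge R m0) _.
by rewrite ler_wpM2r ?sqr_ge0// ler_wpM2l// ler_nat; lia.
Qed.

(** Start at the mode, where [sqrt n * q] is at least 1/2, and move outwards by steps of 2. At most
    [K * sqrt n / 2] steps are made, each costing a factor at least [expR (- (2 * y))]. *)
Lemma point_prob_local_ge (K : R) : 0 < K -> exists2 c : R, 0 < c &
  \forall n \near \oo, forall x : int, `|x|%:~R <= K * Num.sqrt n%:R ->
    (x == n%:Z %[mod 2])%Z -> c <= Num.sqrt n%:R * q n x.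
Proof.
move=> K0; exists (expR (- (4 * K ^+ 2)) / 2).
  by rewrite divr_gt0// expR_gt0.
near=> n.
have s1 : 1 <= Num.sqrt n%:R :> R by near: n; exact: near_sqrt_ge.
have sK : 4 * K <= Num.sqrt n%:R by near: n; exact: near_sqrt_ge.
have n0 : (0 < n)%N by near: n; exact: nbhs_infty_gt.
move=> x; set s := Num.sqrt _ in s1 sK * => xK xn.
have sE : s ^+ 2 = n%:R by exact: sqrt_natK.
(* [y] bounds the relative loss [2z / (n + 1 + z)] for [z <= K * s]. The total exponent is at most
   [2 * K ^+ 2], within the claimed [4 * K ^+ 2]. *)
pose y := 2 * K / s.
have s0 : 0 < s by lra.
have ys : y * s = 2 * K by rewrite /y divfK// gt_eqF.
have y01 : 0 <= y <= 2^-1.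
  by rewrite /y divr_ge0 ?(ltW s0)//= ?ler_pdivrMr//; lra.
pose e := (odd n)%:Z.
have stepn k : (e + (2 * k)%N%:Z)%:~R <= K * s ->
    q n e * expR (- (2 * y)) ^+ k <= q n (e + (2 * k)%N%:Z).
  elim: k => [|k IHk] kK; first by rewrite mulr1 addr0.
  pose z := e + (2 * k)%N%:Z + 1.
  have zE : e + (2 * k.+1)%N%:Z = z + 1 by rewrite /z; lia.
  have zE' : e + (2 * k)%N%:Z = z - 1 by rewrite /z; lia.
  rewrite zE in kK *; rewrite zE' in IHk.
  have z0 : 0 <= z%:~R :> R by rewrite ler0z /z /e; lia.
  rewrite !intrD in kK IHk; rewrite mulrN1z in IHk.
  have {IHk} Hk := IHk ltac:(lra).
  have Hr := point_prob_ratio R n z.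
  have Hy := expR_le_1B y01.
  have q0 := point_prob_ge0 R n (z - 1).
  rewrite exprSr mulrA; apply: (@le_trans _ _ (q n (z - 1) * (1 - y))).
    apply: ler_pM => //.
    by rewrite mulr_ge0 ?exprn_ge0 ?expR_ge0 ?point_prob_ge0.
  have nz : 0 < n%:R + 1 + z%:~R :> R by have : 0 <= n%:R :> R by []; lra.
  rewrite -(ler_pM2l nz) -Hr mulrC -mulrA [leRHS]mulrC ler_wpM2l//.
  rewrite -sE in nz *; nra.
have [k xE] : exists k, `|x| = e + (2 * k)%N%:Z.
  exists (`|x|%N./2); have := odd_double_half n; have := odd_double_half `|x|%N.
  by rewrite /e; lia.
have -> : q n x = q n `|x|.
  by have [//|x0] := ger0P x; rewrite point_probN.
have := stepn k; rewrite -xE => /(_ xK) Hq.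
apply: (@le_trans _ _ (s * (q n e * expR (- (2 * y)) ^+ k))); last first.
  by rewrite ler_wpM2l// ltW.
rewrite [leLHS]mulrC [leRHS]mulrA; apply: ler_pM.
- by [].
- exact: expR_ge0.
- exact: point_prob_mod2_ge.
rewrite -expRM_natl ler_expR mulrN lerN2.
have k0 : 2 * k%:R <= K * s.
  apply: le_trans xK; rewrite xE -[2]/(2%:~R) -[k%:R]/(k%:~R) -intrM ler_int.
  by rewrite /e; lia.
nra.
Unshelve. all: by end_near. Qed.

Lemma sum_inv_sqrt n :
  \sum_(0 <= j < n) (Num.sqrt j.+1%:R)^-1 <= 2 * Num.sqrt n%:R :> R.
Proof.
elim: n => [|n IHn]; first by rewrite big_nil mulr_ge0.
rewrite big_nat_recr//=.
have := sqrt_natK n; have := sqrt_natK n.+1; rewrite -[X in _ = X -> _]natr1.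
set a := Num.sqrt n.+1%:R; set b := Num.sqrt n%:R in IHn *.
move=> aE bE; have b0 : 0 <= b by exact: sqrtr_ge0.
have a0 : 0 < a by rewrite sqrtr_gt0.
(* Since [a ^+ 2 - b ^+ 2 = 1], the difference [a - b] is [1 / (a + b)], and [b <= a]. *)
suff : a^-1 <= 2 * (a - b) by move: IHn; lra.
by rewrite -div1r ler_pdivrMr//; nra.
Qed.

(** A fourth root in place of the logarithm matches the exponent 5/4. With fourth roots [a], [b] of
    [n + 1], [n], factoring [a ^+ 4 - b ^+ 4 = 1] gives [1 <= 4 * a ^+ 4 * (a - b)]. *)
Lemma harmonic_le n :
  \sum_(0 <= j < n) j.+1%:R^-1 <= 4 * Num.sqrt (Num.sqrt n%:R) :> R.
Proof.
elim: n => [|n IHn]; first by rewrite big_nil mulr_ge0.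
rewrite big_nat_recr//=.
have r4 m : Num.sqrt (Num.sqrt m%:R) ^+ 4 = m%:R :> R.
  by rewrite (exprM _ 2 2) sqr_sqrtr ?sqrtr_ge0// sqrt_natK.
have := r4 n; have := r4 n.+1; rewrite -[X in _ = X -> _]natr1.
set a := Num.sqrt (Num.sqrt n.+1%:R).
set b := Num.sqrt (Num.sqrt n%:R) in IHn *.
move=> aE bE; have b0 : 0 <= b by exact: sqrtr_ge0.
have ba : b <= a by rewrite /a /b !ler_wsqrtr// ler_nat.
have sqrt1 (x : R) : 1 <= x -> 1 <= Num.sqrt x.
  by move=> x1; rewrite -[leLHS]sqrtr1 ler_wsqrtr.
have a1 : 1 <= a by apply/sqrt1/sqrt1; rewrite ler1n.
suff H : n.+1%:R^-1 <= 4 * (a - b) by apply: (le_trans (lerD IHn H)); lra.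
have -> : n.+1%:R^-1 = 1 / a ^+ 4 by rewrite aE natr1 div1r.
rewrite ler_pdivrMr; last by apply: exprn_gt0; lra.
have abb : 0 <= a - b by lra.
have E1 : a ^+ 4 - b ^+ 4 = 1 by lra.
have E2 : a ^+ 4 - b ^+ 4 =
   (a - b) * (a ^+ 3 + a ^+ 2 * b + a * b ^+ 2 + b ^+ 3) by ring.
have p3 : a ^+ 3 + a ^+ 2 * b + a * b ^+ 2 + b ^+ 3 <= 4 * a ^+ 4.
  have h1 : a ^+ 2 * b <= a ^+ 3 by rewrite [a ^+ 3]exprSr ler_wpM2l ?sqr_ge0.
  have h2 : b ^+ 2 <= a ^+ 2 by rewrite ler_pXn2r ?nnegrE//; lra.
  have h3 : a * b ^+ 2 <= a ^+ 3 by rewrite [a ^+ 3]exprS ler_wpM2l//; lra.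
  have h4 : b ^+ 3 <= a ^+ 3 by rewrite ler_pXn2r ?nnegrE//; lra.
  have h5 : a ^+ 3 <= a ^+ 4 by rewrite ler_weXn2l.
  lra.
have := ler_wpM2l abb p3; lra.
Qed.

End LocalLowerBound.

(** * Meanders *)

Lemma passage_take_uniq x s j k : (j < k <= size s)%N ->
  passage x (take j s) -> passage x (take k s) -> False.
Proof.
move=> /andP[jk ks] /passageP[hj _] /passageP[_ /(_ j)].
by rewrite size_takel// take_takel ?(ltnW jk)// hj ltxx => /(_ jk).
Qed.

(** Steps have size one, so the walk leaves the positive heights exactly at 0. *)
Lemma passage_or_stays x L s : 0 < x -> ~~ stays x (take L s) ->
  exists2 j, (j <= L)%N & (j <= size s)%N && passage x (take j s).
Proof.
elim: s x L => [|b s IHs] x [|L] //= x0; rewrite ?x0//=.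
have [xb|xb] := leP (x + step b) 0.
  move=> _; exists 1%N => //=; rewrite take0 x0/= eq_le xb.
  by case: b {xb} => //=; rewrite /step; lia.
by move=> /IHs-/(_ xb) [j jL js]; exists j.+1 => //=; rewrite x0.
Qed.

Section Meanders.
Variables (R : realType) (n : nat).
Local Notation N := (2 * n)%N.+1.
Local Notation avoid := (avoid N meander_word).
Local Notation v := (survival R N meander_word).
Local Notation h := (passage_prob R).
Local Notation u := (return_prob R).

(** A window opened by an up step inside the excursion contains its end, where the walk is no higher
    than at the start of the window; so no meander begins there. A general [x] is needed for the
    induction on [r]. *)
Lemma avoid_excursion x r z : 0 < x -> (size r <= 2 * n)%N ->
  passage x r -> avoid (true :: r ++ z) = avoid z.
Proof.
have headF y r' : 1 <= y -> (size r' <= 2 * n)%N -> passage y r' ->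
    avoid (true :: r' ++ z) = avoid (r' ++ z).
  move=> y1 sr pr; rewrite avoid_cons /= take_cat.
  have -> : (if (2 * n < size r')%N then take (2 * n) r'
     else r' ++ take (2 * n - size r') z) = r' ++ take (2 * n - size r') z.
    by case: ltnP => //; lia.
  by rewrite (passage_stays_cat _ y1 pr) implybT.
move=> x0 sr pr; rewrite (headF x)//.
elim: r x x0 sr pr => [//|b r IHr] x x0 /= sr /andP[_ pr].
case: b pr => pr; first by rewrite (headF (x + 1)) ?(IHr (x + 1))//; lia.
rewrite avoid_cons /= implybT /=.
have [xE|x1] := eqVneq x 1.
  by move: pr; rewrite xE; case: r {IHr sr} => //= b r; rewrite subrr.
by apply: (IHr (x + step false)) => //; rewrite /step; lia.
Qed.

(** If the walk stays positive for [2 * n] more steps, a meander is read and both sides vanish.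
    Otherwise the only nonzero passage factor is at the first return to 0, and the excursion is cut
    off. *)
Lemma avoid_up s : (2 * n <= size s)%N ->
  (avoid (true :: s))%:R =
  \sum_(0 <= j < N) (passage 1 (take j s))%:R * (avoid (drop j s))%:R :> R.
Proof.
move=> ns; have [st|nst] := boolP (stays 1 (take (2 * n) s)).
  rewrite avoid_cons /= st ltnS ns /= big_nat big1// => j /andP[_ jN].
  case pj : (passage 1 (take j s)); last by rewrite mul0r.
  have := passage_stays_cat (take (2 * n - j) (drop j s)) (lexx 1) pj.
  by rewrite -takeD subnKC// st.
have [//|j jN /andP[js pj]] := passage_or_stays _ nst.
rewrite big_mkord (bigD1 (Ordinal (jN : j < N)%N))//= pj mul1r big1 ?addr0.
  rewrite -[s in LHS](cat_take_drop j) (avoid_excursion _ _ _ pj)//.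
  by rewrite size_takel.
move=> i /eqP/eqP ij; case pi : (passage 1 (take i s)); last by rewrite mul0r.
have iN := ltn_ord i.
have [lt|lt|E] := ltngtP i j.
- by case: (@passage_take_uniq 1 s i j) => //; rewrite lt.
- by case: (@passage_take_uniq 1 s j i) => //; rewrite lt /=; lia.
- by case/eqP: ij; exact: val_inj.
Qed.

(** The renewal equation: after a down step, or an excursion of length [j + 1], the search starts
    afresh. *)
Lemma survival_meanderS m : (2 * n <= m)%N ->
  v m.+1 = (v m + \sum_(0 <= j < N) h j 1 * v (m - j)) / 2.
Proof.
move=> nm; rewrite /survival probS addrC; congr ((_ + _) / 2).
  by apply: eq_prob => s _; rewrite avoid_cons /= implybT.
rewrite /prob (@eq_avg _ m _ (fun s => \sum_(0 <= j < N)
    (passage 1 (take j s))%:R * (avoid (drop j s))%:R)).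
  rewrite avg_sum; apply: eq_big_nat => j /andP[_ jN].
  have {1}<- : (j + (m - j) = m)%N by lia.
  exact: (avg_take_drop _ _ (fun s => (passage 1 s)%:R)
                            (fun s => (avoid s)%:R)).
by move=> s szs; rewrite avoid_up// szs.
Qed.

Lemma sum_survival_shift a M : (a <= N)%N ->
  \sum_(0 <= i < M) v (a + i)%N = series v (a + M)%N - a%:R.
Proof.
move=> aN; rewrite /series/= (@big_cat_nat _ _ _ a 0 (a + M))//=; last by lia.
rewrite [X in X + _ - _](_ : _ = a%:R); last first.
  rewrite (eq_big_nat _ _ (F2 := fun=> 1)) => [|i /andP[_ ia]].
    by rewrite big_const_nat iter_addr_0 subn0.
  by rewrite survival_short//; lia.
rewrite addrAC subrr add0r.
transitivity (\sum_(0 + a <= i < a + M) v i); last by rewrite add0n.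
rewrite big_addn addKn.
by apply: eq_bigr => i _; rewrite addnC.
Qed.

Lemma series_survival_meander M :
  series v (N + M)%N = N%:R + (series v (2 * n + M)%N - (2 * n)%N%:R +
    \sum_(0 <= j < N) h j 1 *
      (series v (2 * n - j + M)%N - (2 * n - j)%N%:R)) / 2.
Proof.
apply/eqP; rewrite addrC -subr_eq; apply/eqP.
rewrite -[LHS]sum_survival_shift//.
transitivity (\sum_(0 <= i < M)
    (v (2 * n + i)%N + \sum_(0 <= j < N) h j 1 * v (2 * n + i - j)%N) / 2).
  by apply: eq_bigr => i _; rewrite addSn survival_meanderS// leq_addr.
rewrite -mulr_suml big_split /= sum_survival_shift//; congr ((_ + _) / 2).
rewrite exchange_big /=; apply: eq_big_nat => j /andP[_ jN].
rewrite -mulr_sumr -sum_survival_shift; last by lia.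
by congr (_ * _); apply: eq_bigr => i _; congr survival; lia.
Qed.

(** In the summed renewal equation the passage weights add up to [1 - u n], so
    [S <= N + (S + (1 - u n) * S) / 2], which bounds [S]. *)
Lemma series_survival_le K : series v K <= 2 * N%:R / u n.
Proof.
have u0 := return_prob_gt0 R n.
have mono : {homo series v : a b / (a <= b)%N >-> a <= b}.
  apply/nondecreasing_seqP => k.
  by rewrite /series/= big_nat_recr//= lerDl survival_ge0.
apply: (@le_trans _ _ (series v (N + K)%N)); first by apply: mono; lia.
have h0 j := passage_prob_ge0 R j 1.
have := series_survival_meander K; set S := series v (N + K)%N.
have : \sum_(0 <= j < N) h j 1 *
    (series v (2 * n - j + K)%N - (2 * n - j)%N%:R) <= (1 - u n) * S.
  rewrite -sum_passage_prob mulr_suml; apply: ler_sum => j _.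
  rewrite ler_wpM2l//; apply: (@le_trans _ _ (series v (2 * n - j + K)%N)).
    by rewrite gerBl.
  by apply: mono; lia.
have : series v (2 * n + K)%N <= S by apply: mono; lia.
have : 0 <= (2 * n)%N%:R :> R by [].
rewrite ler_pdivlMr//; lra.
Qed.

(** All shifted partial sums share one limit [V], so the summed renewal equation becomes a linear
    equation for [V]. *)
Lemma cvg_series_survival_meander :
  series v @ \oo --> (4 * n%:R + 1 + (u n)^-1 : R).
Proof.
have cv : cvgn (series v).
  apply: nondecreasing_is_cvgn.
    apply/nondecreasing_seqP => k.
    by rewrite /series/= big_nat_recr//= lerDl survival_ge0.
  by exists (2 * N%:R / u n) => _ [K _ <-]; exact: series_survival_le.
have [V Vl] : exists V : R, series v @ \oo --> V by exists (limn (series v)).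
have shift a : (fun M => series v (a + M)%N) @ \oo --> V.
  rewrite (_ : (fun M => _) = [sequence series v (M + a)%N]_M).
    by rewrite cvg_shiftn.
  by apply/funext => M; rewrite addnC.
suff <- : V = 4 * n%:R + 1 + (u n)^-1 by [].
have limE : V = N%:R + (V - (2 * n)%N%:R +
    \sum_(0 <= j < N) h j 1 * (V - (2 * n - j)%N%:R)) / 2.
  apply: (@cvg_unique _ (@Rhausdorff R) _ _ _ _ (shift N)).
  rewrite (funext series_survival_meander).
  apply: cvgD; first exact: cvg_cst.
  apply: cvgM; last exact: cvg_cst.
  apply: cvgD; first by apply: cvgB; [exact: shift|exact: cvg_cst].
  apply: cvg_big => [|j _]; first exact: add_continuous.
  apply: cvgM; first exact: cvg_cst.
  by apply: cvgB; [exact: shift|exact: cvg_cst].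
have sumE : \sum_(0 <= j < N) h j 1 * (V - (2 * n - j)%N%:R) =
    (V - N%:R) * (1 - u n) + 2 * n%:R * u n.
  rewrite -sum_passage_prob -sum_passage_prob_mean mulr_sumr -big_split /=.
  apply: eq_big_nat => j /andP[_ jN].
  have -> : (2 * n - j)%N%:R = N%:R - j.+1%:R :> R by rewrite -natrB.
  by ring.
have u0 := return_prob_gt0 R n.
apply: (@mulfI _ (u n)); first by rewrite gt_eqF.
rewrite mulrDr divff ?gt_eqF//.
move: limE; rewrite sumE -[N%:R]natr1 natrM; lra.
Qed.

End Meanders.

(** * The four classes *)

Section SurvivalSeries.
Variables (R : realType) (N : nat) (A : pred (seq bool)).
Local Notation v := (survival R N A).

Lemma eseries_survivalE K :
  (\sum_(0 <= m < K) (v m)%:E)%E = (series v K)%:E.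
Proof. by rewrite sumEFin. Qed.

Lemma eseries_survival_le (B : R) : (forall K, series v K <= B) ->
  (\sum_(0 <= m <oo) (v m)%:E <= B%:E)%E.
Proof.
move=> SB; apply: lime_le.
  by apply: is_cvg_nneseries => k _ _; rewrite lee_fin survival_ge0.
by near=> K; rewrite eseries_survivalE lee_fin.
Unshelve. all: by end_near. Qed.

Lemma eseries_survival_ge : (N%:R%:E <= \sum_(0 <= m <oo) (v m)%:E)%E.
Proof.
apply: (@le_trans _ _ (\sum_(0 <= m < N) (v m)%:E)%E); last first.
  by apply: nneseries_lim_ge => k _ _; rewrite lee_fin survival_ge0.
rewrite sumEFin lee_fin (eq_big_nat _ _ (F2 := fun=> 1)) => [|m /andP[_ mN]].
  by rewrite big_const_nat iter_addr_0 subn0.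
exact: survival_short.
Qed.

Lemma eseries_survival_cvg (V : R) : series v @ \oo --> V ->
  (\sum_(0 <= m <oo) (v m)%:E)%E = V%:E.
Proof.
move=> Vl; rewrite (_ : (fun K => _) = EFin \o series v); last first.
  by apply/funext => K; exact: eseries_survivalE.
by rewrite EFin_lim; [congr EFin; exact/cvg_lim|apply/cvg_ex; exists V].
Qed.

Lemma series_survival_mono : {homo series v : a b / (a <= b)%N >-> a <= b}.
Proof.
apply/nondecreasing_seqP => k.
by rewrite /series/= big_nat_recr//= lerDl survival_ge0.
Qed.

(** Only [j = 0] contributes to the overlaps, so [p * series v K <= 1]. Hence the series converges,
    [v] tends to 0, and [sum_survival_ge] squeezes the product to 1. *)
Lemma cvg_series_survival_nonoverlapping : (0 < N)%N -> 0 < prob R N A ->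
  (forall j r z, (0 < j < N)%N -> size r = N -> size z = j -> A r ->
    ~~ A (drop j (r ++ z))) ->
  series v @ \oo --> (prob R N A)^-1.
Proof.
move=> N0 p0 noverlap; set p := prob R N A in p0 *.
have le1 K : p * series v K <= 1.
  pose c j : R := (j == 0)%N%:R.
  have := @sum_survival_le R N A N0 c _ _ K; rewrite -/p.
  have -> : \sum_(0 <= j < N) c j = 1.
    rewrite -(prednK N0) big_nat_recl// big1 ?addr0// => j _.
  apply=> [j|[|j] r jN szr Ar]; first exact: ler0n.
    exact: prob_le1.
  by rewrite prob0// => z szz; apply: noverlap.
have cv : cvgn (series v).
  apply: nondecreasing_is_cvgn; first exact: series_survival_mono.
  exists p^-1 => _ [K _ <-].
  by rewrite -[p^-1]div1r ler_pdivlMr// mulrC.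
have v0 : v @ \oo --> (0 : R) by exact: cvg_series_cvg_0.
have pS : (fun K => p * series v K) @ \oo --> (1 : R).
  apply: (@squeeze_cvgr _ _ _ _ (fun K => 1 - v (K + N.-1)%N) (fun=> 1)).
  - near=> K; rewrite le1 andbT; exact: sum_survival_ge.
  - rewrite -[X in _ --> X]subr0; apply: cvgB; first exact: cvg_cst.
    by rewrite (cvg_shiftn N.-1 v).
  - exact: cvg_cst.
rewrite (_ : series v = fun K => p^-1 * (p * series v K)); last first.
  by apply/funext => K; rewrite mulKf// gt_eqF.
rewrite -[X in _ --> X]mulr1; apply: cvgM => //; exact: cvg_cst.
Unshelve. all: by end_near. Qed.

End SurvivalSeries.

(** * Probabilities and overlaps of the pattern classes *)

Section PatternClasses.
Variable R : realType.
Local Notation u := (return_prob R).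

Lemma prob_excursion_word n :
  prob R (2 * n.+1) excursion_word = u n.+1 / (2 * (2 * n%:R + 1)).
Proof.
rewrite (_ : (2 * n.+1 = (2 * n).+2)%N); last by lia.
rewrite probS [X in _ + X](_ : _ = 0); last by apply: prob0.
rewrite addr0 [X in X / 2](_ : _ = passage_prob R (2 * n).+1 1)//.
rewrite passage_prob_odd1.
by have n0 : 0 <= n%:R :> R by []; field; lra.
Qed.

(** A second excursion would start at a positive height of the first one and fall below it, at an
    interior time, when the first ends at 0. *)
Lemma excursion_word_nonoverlapping j r z :
  (0 < j < size r)%N -> size z = j -> excursion_word r ->
  ~~ excursion_word (drop j (r ++ z)).
Proof.
case: j => // j; case: r => [|[] r] //= jr szz.
rewrite -{1}(cat_take_drop j r) drop_cat_le; last by lia.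
have : (0 < size (drop j r))%N by rewrite size_drop; lia.
set a := take j r; case: (drop j r) => [|b s] //= _.
rewrite passage_cat => /andP[/stays_gt0 sa pb].
case: b pb => // pb; apply/negP.
rewrite passage_cat; case: z szz => // c z _ /andP[/stays_gt0 ss _].
by move: pb => /passageP[]; rewrite hgt_cons /step; lia.
Qed.

(** The [j] new letters must have a total height fixed by [r]. *)
Lemma bridge_overlap (l : int) j r : (j <= size r)%N ->
  prob R j (fun z => hgt (drop j (r ++ z)) == l) <= (Num.sqrt j.+1%:R)^-1.
Proof.
move=> jr.
have -> : prob R j (fun z => hgt (drop j (r ++ z)) == l) =
    point_prob R j (l - hgt (drop j r)).
  apply: eq_prob => z _; rewrite drop_cat_le// hgt_cat; lia.
have qs := point_prob_le R j (l - hgt (drop j r)).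
rewrite -(sqrt_natK R) in qs.
have s0 : 0 < Num.sqrt j.+1%:R :> R by rewrite sqrtr_gt0.
have := point_prob_ge0 R j (l - hgt (drop j r)).
move: (point_prob _ _ _) (Num.sqrt _) s0 qs => q s s0 qs q0.
rewrite -div1r ler_pdivlMr// mulrC; move: qs (mulr_ge0 (ltW s0) q0).
by rewrite -exprMn; move: (s * q) => x; nra.
Qed.

(** The value at 0 is set apart because [2 / 0] is 0 by convention. *)
Definition passage_overlap_bound (j : nat) : R :=
  if j is 0 then 1 else 2 / j%:R.

(** The [j] new letters must form a first passage from the level reached at the end of [r]. *)
Lemma passage_overlap (x : int) j r : (j <= size r)%N ->
  prob R j (fun z => passage x (drop j (r ++ z))) <= passage_overlap_bound j.
Proof.
case: j => [|j] jr; first exact: prob_le1.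
apply: le_trans (passage_prob_le R (x + hgt (drop j.+1 r)) (ltn0Sn j)).
apply: ler_prob => z szz; rewrite drop_cat_le//.
by rewrite passage_cat; case: z szz => // c z _ /andP[].
Qed.

Lemma sum_passage_overlap n : (0 < n)%N ->
  \sum_(0 <= j < n) passage_overlap_bound j <= 9 * Num.sqrt (Num.sqrt n%:R).
Proof.
case: n => // n _; rewrite big_nat_recl//= -mulr_sumr.
have := harmonic_le R n.
have le_nS : Num.sqrt (Num.sqrt n%:R) <= Num.sqrt (Num.sqrt n.+1%:R) :> R.
  by rewrite !ler_wsqrtr// ler_nat.
have sqrt1 (x : R) : 1 <= x -> 1 <= Num.sqrt x.
  by move=> x1; rewrite -[leLHS]sqrtr1 ler_wsqrtr.
have : 1 <= Num.sqrt (Num.sqrt n.+1%:R) :> R.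
  by apply/sqrt1/sqrt1; rewrite ler1n.
move: (\sum_(_ <= _ < _) _) => S; lra.
Qed.

Lemma lambda_int_bounds (lam : R) n :
  lam * Num.sqrt n%:R - 1 <= (lambda_int lam n)%:~R <=
  lam * Num.sqrt n%:R + 1.
Proof.
rewrite /lambda_int; set x := lam * _.
have := floor_le x; have := lt_succ_floor x; rewrite intrD.
by case: ifP => _; rewrite ?intrD; lra.
Qed.

Lemma lambda_int_parity (lam : R) n : (lambda_int lam n == n%:Z %[mod 2])%Z.
Proof. by rewrite /lambda_int; case: ifP => // /negbT; lia. Qed.

Lemma point_prob_lambda_int_ge (lam : R) : exists2 c : R, 0 < c &
  \forall n \near \oo,
    c <= Num.sqrt n%:R * point_prob R n (lambda_int lam n).
Proof.
have K0 : 0 < `|lam| + 1 by rewrite ltr_wpDl.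
have [c c0 Hc] := point_prob_local_ge K0.
exists c => //; near=> n.
have s1 : 1 <= Num.sqrt n%:R :> R by near: n; exact: near_sqrt_ge.
(* The extra 1 in [K] absorbs the rounding in [lambda_int], as [sqrt n >= 1]. *)
have : forall x : int, `|x|%:~R <= (`|lam| + 1) * Num.sqrt n%:R ->
    (x == n%:Z %[mod 2])%Z -> c <= Num.sqrt n%:R * point_prob R n x.
  by near: n; exact: Hc.
apply; last exact: lambda_int_parity.
have := lambda_int_bounds lam n; rewrite intr_norm ler_norml.
have := ler_norm lam; have := lerNnormlW (lexx `|lam|).
by move: (Num.sqrt _) s1 => s s1 l1 l2 /andP[h1 h2]; apply/andP; split; nra.
Unshelve. all: by end_near. Qed.

End PatternClasses.

(** The shift skips [n = 0], where the comparison sequences vanish and the excursion formula does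
    not apply. *)
Lemma asymp_equivS (R : realType) (a b : nat -> \bar R) (A B : nat -> R) :
  (forall n, a n.+1 = (A n)%:E) -> (forall n, b n.+1 = (B n)%:E) ->
  (forall n, B n != 0) -> (fun n => A n / B n) @ \oo --> (1 : R) ->
  asymp_equiv a b.
Proof.
move=> aE bE B0 AB; rewrite /asymp_equiv -cvg_shiftS.
rewrite (_ : [sequence _]_n = EFin \o (fun n => A n / B n)); last first.
  by apply/funext => n /=; rewrite aE bE inver (negbTE (B0 n)) -EFinM.
by apply: cvg_comp AB _.
Qed.

(** * Asymptotics of the return probability *)

Section ReturnAsymptotics.
Variable R : realType.
Local Notation u := (return_prob R).

(** [n * u n ^+ 2] is nondecreasing, at most 1 and eventually at least 1/4; monotone convergence
    gives a positive limit without computing it. *)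
Lemma cvg_sqrt_return_prob : exists2 L : R, 0 < L &
  (fun n => Num.sqrt n.+1%:R * u n.+1) @ \oo --> L.
Proof.
pose w n : R := n%:R * u n ^+ 2.
have wmono : {homo w : a b / (a <= b)%N >-> a <= b}.
  by apply/nondecreasing_seqP => k; exact: return_prob_mono.
have wle n : w n <= 1.
  have := return_prob_le R n; rewrite /w; have := sqr_ge0 (u n).
  have : 0 <= n%:R :> R by [].
  nra.
have cw : cvgn w.
  by apply: nondecreasing_is_cvgn => //; exists 1 => _ [n _ <-].
have W0 : 4^-1 <= limn w.
  apply: limr_ge => //; near=> n.
  have n0 : (0 < n)%N by near: n; exact: nbhs_infty_gt.
  by have := return_prob_ge R n0; rewrite /w; lra.
exists (Num.sqrt (limn w)); first by rewrite sqrtr_gt0; lra.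
rewrite (_ : (fun n => _) = [sequence (Num.sqrt \o w) n.+1]_n); last first.
  apply/funext => n; rewrite /w /= sqrtrM// sqrtr_sqr ger0_norm//.
  exact/ltW/return_prob_gt0.
by rewrite cvg_shiftS; apply: continuous_cvg => //; exact: sqrt_continuous.
Unshelve. all: by end_near. Qed.

Lemma cvg_inv_sqrt : (fun n => (Num.sqrt n.+1%:R)^-1) @ \oo --> (0 : R).
Proof.
rewrite (_ : (fun n => _) = Num.sqrt \o (@harmonic R)); last first.
  by apply/funext => n; rewrite /harmonic /= sqrtrV.
rewrite -[X in _ --> X]sqrtr0.
by apply: continuous_cvg; [exact: sqrt_continuous|exact: cvg_harmonic].
Qed.

Lemma powR_3_2 n : n%:R `^ (3 / 2) = n%:R * Num.sqrt n%:R :> R.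
Proof.
have -> : 3 / 2 = 1 + 2^-1 :> R by lra.
rewrite powRD; last by apply/implyP => /eqP; lra.
by rewrite powRr1// powR12_sqrt.
Qed.

Lemma powR_5_4 n : n%:R `^ (5 / 4) = n%:R * Num.sqrt (Num.sqrt n%:R) :> R.
Proof.
have -> : 5 / 4 = 1 + 2^-1 * 2^-1 :> R by lra.
rewrite powRD; last by apply/implyP => /eqP; lra.
by rewrite powRr1// powRrM !powR12_sqrt.
Qed.

End ReturnAsymptotics.

(** * Expected waiting times of the four classes *)

Section ExpectedWaitingTimes.
Context (R : realType) d (T : measurableType d) (P : probability T R).
Variable RW : nat -> {RV P >-> R}.
Hypothesis hRW : simple_random_walk RW.
Local Notation u := (return_prob R).

Lemma expected_waiting_excursions n :
  expected_waiting_time RW (excursions R n.+1) =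
  (2 * (2 * n%:R + 1) / u n.+1)%:E.
Proof.
rewrite (expected_waiting_timeE hRW _ (@encodes_excursions R n.+1 isT))//.
have u0 := return_prob_gt0 R n.+1; have n0 : 0 <= n%:R :> R by [].
have p0 : 0 < prob R (2 * n.+1) excursion_word.
  by rewrite prob_excursion_word divr_gt0//; lra.
rewrite (eseries_survival_cvg (cvg_series_survival_nonoverlapping _ p0 _))//.
  by rewrite prob_excursion_word invf_div.
move=> j r z jN szr szz; apply: excursion_word_nonoverlapping => //.
by rewrite szr.
Qed.

Lemma expected_waiting_meanders n :
  expected_waiting_time RW (meanders R n) = (4 * n%:R + 1 + (u n)^-1)%:E.
Proof.
rewrite (expected_waiting_timeE hRW _ (@encodes_meanders R n)) ?addn1//.
by rewrite (eseries_survival_cvg (@cvg_series_survival_meander R n)).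
Qed.

Lemma expected_waiting_ge N (A : set (path_of R N)) A' : (0 < N)%N ->
  encodes A' A -> (N%:R%:E <= expected_waiting_time RW A)%E.
Proof.
move=> N0 AA'; rewrite (expected_waiting_timeE hRW N0 AA').
exact: eseries_survival_ge.
Qed.

Lemma expected_waiting_le N (A : set (path_of R N)) A' c (C p : R) :
  (0 < N)%N -> encodes A' A -> (forall j, 0 <= c j) ->
  (forall j r, (j < N)%N -> size r = N -> A' r ->
    prob R j (fun z => A' (drop j (r ++ z))) <= c j) ->
  \sum_(0 <= j < N) c j <= C -> 0 < p -> p <= prob R N A' ->
  (expected_waiting_time RW A <= (C / p)%:E)%E.
Proof.
move=> N0 AA' c0 Hc cC p0 pA; rewrite (expected_waiting_timeE hRW N0 AA').
apply: eseries_survival_le => K; rewrite ler_pdivlMr// mulrC.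
apply: le_trans cC; apply: le_trans (sum_survival_le N0 c0 Hc K).
rewrite ler_wpM2r// /series/= sumr_ge0// => k _; exact: survival_ge0.
Qed.

Lemma excursions_asymp : exists C : R, 0 < C /\
  asymp_equiv (fun n => expected_waiting_time RW (excursions R n))
              (fun n => (C * n%:R `^ (3 / 2))%:E).
Proof.
have [L L0 Ll] := cvg_sqrt_return_prob R.
(* E T is [2 (2n + 1) / u n.+1], where [u n.+1] is of order [L / sqrt n]. *)
exists (4 / L); split; first by rewrite divr_gt0.
apply: (asymp_equivS (A := fun n => 2 * (2 * n%:R + 1) / u n.+1)
  (B := fun n => 4 / L * (n.+1%:R * Num.sqrt n.+1%:R))).
- exact: expected_waiting_excursions.
- by move=> n; rewrite powR_3_2.
- by move=> n; rewrite !mulf_neq0 ?invr_neq0 ?gt_eqF// sqrtr_gt0.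
rewrite (_ : (fun n => _) =
  fun n => (1 - harmonic n / 2) * (L * (Num.sqrt n.+1%:R * u n.+1)^-1)).
  rewrite [X in _ --> X](_ : _ = (1 - 0 * 2^-1) * (L * L^-1)); last first.
    by rewrite mul0r subr0 mul1r divff// gt_eqF.
  apply: cvgM.
    apply: cvgB; first exact: cvg_cst.
    by apply: cvgM; [exact: cvg_harmonic|exact: cvg_cst].
  apply: cvgM; first exact: cvg_cst.
  by apply: cvgV => //; rewrite gt_eqF.
apply/funext => n; rewrite /harmonic /=.
have u0 := return_prob_gt0 R n.+1; have n0 : 0 <= n%:R :> R by [].
have s0 : 0 < Num.sqrt n.+1%:R :> R by rewrite sqrtr_gt0.
move: (Num.sqrt _) (u _) s0 u0 => s v s0 u0; rewrite -natr1.
by field; do ?[apply/andP; split]; lra.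
Qed.

Lemma meanders_asymp : exists C : R, 0 < C /\
  asymp_equiv (fun n => expected_waiting_time RW (meanders R n))
              (fun n => (C * n%:R)%:E).
Proof.
have [L L0 Ll] := cvg_sqrt_return_prob R.
(* The term [(u n)^-1] is of order [sqrt n], negligible against [4n]. *)
exists 4; split => //.
apply: (asymp_equivS (A := fun n => 4 * n.+1%:R + 1 + (u n.+1)^-1)
  (B := fun n => 4 * n.+1%:R)) => [n|n|n|].
- exact: expected_waiting_meanders.
- by [].
- by rewrite mulf_neq0.
rewrite (_ : (fun n => _) = fun n => 1 + 4^-1 * (harmonic n +
    (Num.sqrt n.+1%:R)^-1 * (Num.sqrt n.+1%:R * u n.+1)^-1)).
  rewrite [X in _ --> X](_ : _ = 1 + 4^-1 * (0 + 0 * L^-1)); last first.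
    by rewrite mul0r addr0 mulr0 addr0.
  apply: cvgD; first exact: cvg_cst.
  apply: cvgM; first exact: cvg_cst.
  apply: cvgD; first exact: cvg_harmonic.
  by apply: cvgM; [exact: cvg_inv_sqrt|apply: cvgV => //; rewrite gt_eqF].
apply/funext => n; rewrite /harmonic /=.
have u0 := return_prob_gt0 R n.+1; have n0 : 0 < n.+1%:R :> R by [].
have s0 : 0 < Num.sqrt n.+1%:R :> R by rewrite sqrtr_gt0.
move: (Num.sqrt _) (u _) s0 u0 (sqrt_natK R n.+1) => s v s0 u0 <-.
by field; do ?[apply/andP; split]; lra.
Qed.

Lemma bridges_bounds (lam : R) : exists c C : R, [/\ 0 < c, 0 < C &
  \forall n \near \oo,
    ((c * n%:R)%:E <= expected_waiting_time RW (bridges lam n)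
      <= (C * n%:R)%:E)%E].
Proof.
have [c c0 Hc] := point_prob_lambda_int_ge lam.
(* No pattern is complete before time [n], hence the 1; the overlaps sum to at most [2 sqrt n], and
   the pattern probability is at least [c / sqrt n]. *)
exists 1, (2 / c); split; rewrite ?divr_gt0//; near=> n.
have n0 : (0 < n)%N by near: n; exact: nbhs_infty_gt.
have s0 : 0 < Num.sqrt n%:R :> R by rewrite sqrtr_gt0 ltr0n.
have cq : c <= Num.sqrt n%:R * point_prob R n (lambda_int lam n).
  by near: n; exact: Hc.
rewrite mul1r (expected_waiting_ge n0 (@encodes_bridges R lam n))/=.
have -> : 2 / c * n%:R = 2 * Num.sqrt n%:R / (c / Num.sqrt n%:R).
  move: (Num.sqrt _) s0 (sqrt_natK R n) => s s0 <-.
  by field; do ?[apply/andP; split]; lra.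
apply: (expected_waiting_le (c := fun j => (Num.sqrt j.+1%:R)^-1) n0
  (@encodes_bridges R lam n)).
- by move=> j; rewrite invr_ge0 sqrtr_ge0.
- by move=> j r jn szr _; apply: bridge_overlap; rewrite szr ltnW.
- exact: sum_inv_sqrt.
- by rewrite divr_gt0.
- by rewrite ler_pdivrMr// mulrC.
Unshelve. all: by end_near. Qed.

Lemma first_passages_bounds (lam : R) : lam < 0 ->
  exists c C : R, [/\ 0 < c, 0 < C &
  \forall n \near \oo,
    ((c * n%:R)%:E <= expected_waiting_time RW (first_passages lam n)
      <= (C * n%:R `^ (5 / 4))%:E)%E].
Proof.
move=> lam0; have [c c0 Hc] := point_prob_lambda_int_ge lam.
(* The overlaps sum to at most 9 times the fourth root of [n]. By the hitting time theorem the
   pattern probability is [x q / n], with [x >= - lam / 2 * sqrt n] and [q >= c / sqrt n]. *)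
exists 1, (9 / (- lam / 2 * c)); split=> //.
  by rewrite divr_gt0// mulr_gt0//; lra.
near=> n.
have n0 : (0 < n)%N by near: n; exact: nbhs_infty_gt.
have s0 : 0 < Num.sqrt n%:R :> R by rewrite sqrtr_gt0 ltr0n.
(* From here on, the rounding error 1 costs at most half of [- lam * sqrt n]. *)
have sl : 2 / (- lam) <= Num.sqrt n%:R by near: n; exact: near_sqrt_ge.
have cq : c <= Num.sqrt n%:R * point_prob R n (lambda_int lam n).
  by near: n; exact: Hc.
have nR : 0 < n%:R :> R by rewrite ltr0n.
rewrite mul1r (expected_waiting_ge n0 (@encodes_first_passages R lam n))/=.
rewrite powR_5_4.
have -> : 9 / (- lam / 2 * c) * (n%:R * Num.sqrt (Num.sqrt n%:R)) =
    9 * Num.sqrt (Num.sqrt n%:R) / (- lam / 2 * c / n%:R).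
  by field; do ?[apply/andP; split]; lra.
apply: (expected_waiting_le (c := @passage_overlap_bound R) n0
  (@encodes_first_passages R lam n)).
- by case=> [|j]//=; rewrite divr_ge0.
- by move=> j r jn szr _; apply: passage_overlap; rewrite szr ltnW.
- exact: sum_passage_overlap.
- by rewrite divr_gt0// mulr_gt0//; lra.
have xs : - lam / 2 * Num.sqrt n%:R <= (- lambda_int lam n)%:~R.
  have := lambda_int_bounds lam n; rewrite intrN => /andP[_].
  move: sl; rewrite ler_pdivrMr; [|lra]; lra.
have x0 : 0 <= - lambda_int lam n.
  rewrite -(ler0z R); apply: le_trans xs.
  by rewrite mulr_ge0// ?ltW//; lra.
rewrite ler_pdivrMr// mulrC [leRHS]mulrC -[prob _ _ _]/(passage_prob R n _).
rewrite hitting_time_theorem// point_probN.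
have q0 := point_prob_ge0 R n (lambda_int lam n).
move: xs cq s0; set x := _%:~R; move: x (point_prob _ _ _) q0 (Num.sqrt _).
move=> x q q0 s xs cq s0.
apply: (@le_trans _ _ (- lam / 2 * s * q)); last by rewrite ler_wpM2r.
rewrite [leLHS]mulrC -[leRHS]mulrA ler_wpM2l//; lra.
Unshelve. all: by end_near. Qed.

End ExpectedWaitingTimes.

Theorem theorem1p8 (R : realType) (d : measure_display) (T : measurableType d)
    (P : probability T R) (RW : nat -> {RV P >-> R})
    (hRW : simple_random_walk RW) :
  [/\ (exists C : R, 0 < C /\
         asymp_equiv (fun n => expected_waiting_time RW (excursions R n))
                     (fun n => (C * n%:R `^ (3 / 2))%:E)),
      (exists C : R, 0 < C /\
         asymp_equiv (fun n => expected_waiting_time RW (meanders R n))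
                     (fun n => (C * n%:R)%:E)),
      (forall lam : R, exists c C : R, [/\ 0 < c, 0 < C &
         \forall n \near \oo,
           ((c * n%:R)%:E <= expected_waiting_time RW (bridges lam n)
             <= (C * n%:R)%:E)%E]) &
      (forall lam : R, lam < 0 -> exists c C : R, [/\ 0 < c, 0 < C &
         \forall n \near \oo,
           ((c * n%:R)%:E <= expected_waiting_time RW (first_passages lam n)
             <= (C * n%:R `^ (5 / 4))%:E)%E])].
Proof.
split.
- exact: excursions_asymp hRW.
- exact: meanders_asymp hRW.
- exact: bridges_bounds hRW.
- exact: first_passages_bounds hRW.
Qed.
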